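(* Let $R$ be a ring. The following conditions are equivalent: (1) $R$ is left GF-closed. (2) The class $\mathscr{GF}(R)$ of all Gorenstein flat left $R$-modules is projectively resolving. (3) For every short exact sequence of left $R$-modules $0\to G_1\to G_0\to M\to 0$ in which $G_0$ and $G_1$ are Gorenstein flat, if $\mathrm{Tor}^R_1(I,M)=0$ for all injective right $R$-modules $I$, then $M$ is Gorenstein flat.
   Context: All rings are associative with identity and all modules are unitary. A left $R$-module $M$ is Gorenstein flat if there exists an exact sequence of flat left $R$-modules $\cdots\to F_1\to F_0\to F^0\to F^1\to\cdots$ such that $M\cong \mathrm{Im}(F_0\to F^0)$ and such that $I\otimes_R -$ leaves the sequence exact whenever $I$ is an injective right $R$-module. $\mathscr{GF}(R)$ denotes the class of all Gorenstein flat left $R$-modules. A class $\mathscr{X}$ of left $R$-modules is closed under extensions if for every short exact sequence of left $R$-modules $0\to A\to B\to C\to 0$ with $A,C\in\mathscr{X}$ one has $B\in\mathscr{X}$; it is closed under kernels of epimorphisms if for every such sequence with $B,C\in\mathscr{X}$ one has $A\in\mathscr{X}$. $\mathscr{X}$ is projectively resolving if it contains all projective left $R$-modules and is closed under both extensions and kernels of epimorphisms. A ring $R$ is left GF-closed if $\mathscr{GF}(R)$ is closed under extensions. *)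

(* Defs.v *)
From HB Require Import structures.
From mathcomp Require Import all_boot all_algebra.
From mathcomp Require Import finmap boolp monalg.

Set Implicit Arguments.
Unset Strict Implicit.
Unset Printing Implicit Defensive.

Import GRing.Theory.
Local Open Scope ring_scope.
Local Open Scope quotient_scope.

(* Rings are [pzRingType]s: associative, unital, possibly zero.  A right
   R-module is a left module over the converse ring R^c, so that the right
   action x.a is written [(a : R^c) *: x]. *)
Notation rmodType R := (lmodType (R^c)).

(* The tensor product A (x)_R M of a right and a left R-module: the free       *)
(* abelian group on A * M modulo the subgroup generated by the relations of    *)
(* biadditivity and of R-balancedness.                                         *)

Section Tensor.
Variables (R : pzRingType) (A : rmodType R) (M : lmodType R).

Definition tensor_free := {malg int[(A * M)%type]}.

Inductive tensor_relator : tensor_free -> Prop :=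
| TensorDl x y m :
    tensor_relator (<< (x + y, m) >> - << (x, m) >> - << (y, m) >>)
| TensorDr x m n :
    tensor_relator (<< (x, m + n) >> - << (x, m) >> - << (x, n) >>)
| TensorZ x (a : R) m :
    tensor_relator (<< ((a : R^c) *: x, m) >> - << (x, a *: m) >>).

Definition tensor_rel : {pred tensor_free} := fun g =>
  `[< forall S : {pred tensor_free}, zmod_closed S ->
        (forall r, tensor_relator r -> r \in S) -> g \in S >].

Lemma tensor_rel_zmod_closed : zmod_closed tensor_rel.
Proof.
split; first by apply/asboolP => S [].
move=> g h /asboolP gS /asboolP hS; apply/asboolP => S zS rS.
by apply: zS.2; [exact: gS | exact: hS].
Qed.

HB.instance Definition _ :=
  GRing.isZmodClosed.Build tensor_free tensor_rel tensor_rel_zmod_closed.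

Definition tensor : zmodType := Quotient.quot tensor_rel.

Definition tens (x : A) (m : M) : tensor := \pi_tensor << (x, m) >>.

Definition balanced (G : zmodType) (phi : A -> M -> G) :=
  [/\ forall x y m, phi (x + y) m = phi x m + phi y m,
      forall x m n, phi x (m + n) = phi x m + phi x n &
      forall x (a : R) m, phi ((a : R^c) *: x) m = phi x (a *: m)].

Lemma tensor_rel_relator r : tensor_relator r -> r \in tensor_rel.
Proof. by move=> hr; apply/asboolP => S _; exact. Qed.

Lemma pi_tensor_eq g h : g - h \in tensor_rel -> \pi_tensor g = \pi_tensor h.
Proof. by rewrite Quotient.idealrBE => /eqP. Qed.

Lemma pi_tensorD g h : \pi_tensor (g + h) = \pi_tensor g + \pi_tensor h.
Proof. exact: (@pi_addr _ _ _ _ _ (Quotient.quot tensor_rel)). Qed.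

Lemma pi_tensorN g : \pi_tensor (- g) = - \pi_tensor g.
Proof. exact: (@pi_oppr _ _ _ _ _ (Quotient.quot tensor_rel)). Qed.

Lemma pi_tensorB g h : \pi_tensor (g - h) = \pi_tensor g - \pi_tensor h.
Proof. by rewrite pi_tensorD pi_tensorN. Qed.

HB.instance Definition _ := GRing.isZmodMorphism.Build tensor_free tensor
  (\pi_tensor : tensor_free -> tensor) pi_tensorB.

Lemma tens_balanced : balanced tens.
Proof.
split=> [x y m|x m n|x a m]; rewrite /tens.
- rewrite -pi_tensorD; apply/pi_tensor_eq/tensor_rel_relator.
  by rewrite opprD addrA; exact: TensorDl.
- rewrite -pi_tensorD; apply/pi_tensor_eq/tensor_rel_relator.
  by rewrite opprD addrA; exact: TensorDr.
- exact/pi_tensor_eq/tensor_rel_relator/TensorZ.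
Qed.

Section Lift.
Variables (G : zmodType) (phi : A -> M -> G).

Definition free_lift (g : tensor_free) : G :=
  \sum_(k <- msupp g) phi k.1 k.2 *~ g@_k.

Lemma free_liftEw (g : tensor_free) (d : {fset A * M}) :
  (msupp g `<=` d)%fset -> free_lift g = \sum_(k <- d) phi k.1 k.2 *~ g@_k.
Proof.
move=> led; rewrite /free_lift (big_fset_incl _ led) // => k _ kNg.
by rewrite mcoeff_outdom // mulr0z.
Qed.

Lemma free_lift_is_zmod_morphism : zmod_morphism free_lift.
Proof.
move=> g h; pose d := (msupp g `|` msupp h)%fset.
rewrite (@free_liftEw g d) ?fsubsetUl // (@free_liftEw h d) ?fsubsetUr //.
rewrite (@free_liftEw (g - h) d) ?msuppB_le // -sumrB.
by apply: eq_bigr => k _; rewrite mcoeffB mulrzBr.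
Qed.

HB.instance Definition _ :=
  GRing.isZmodMorphism.Build tensor_free G free_lift free_lift_is_zmod_morphism.

Lemma free_liftU x m : free_lift << (x, m) >> = phi x m.
Proof.
by rewrite /free_lift msuppU oner_eq0 big_seq_fset1 mcoeffUU mulr1z.
Qed.

(* Meaningful for balanced phi only: see [tensor_lift_pi]. *)
Definition tensor_lift (t : tensor) : G := free_lift (repr t).

Hypothesis phi_bal : balanced phi.

Lemma free_lift_rel g : g \in tensor_rel -> free_lift g = 0.
Proof.
case: phi_bal => phiDl phiDr phiZ /asboolP gP.
have fB := free_lift_is_zmod_morphism.
have f0 : free_lift 0 = 0 by have := fB 0 0; rewrite !subrr.
apply/eqP; apply: (gP [pred g | free_lift g == 0]).
  split=> [|u v]; first by rewrite inE f0.
  by rewrite !inE fB => /eqP -> /eqP ->; rewrite subrr.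
move=> _ [x y m|x m n|x a m]; rewrite inE !fB !free_liftU.
- by rewrite phiDl [phi x m + _]addrC addrK subrr.
- by rewrite phiDr [phi x m + _]addrC addrK subrr.
- by rewrite phiZ subrr.
Qed.

Lemma tensor_lift_pi g : tensor_lift (\pi g) = free_lift g.
Proof.
apply/eqP; rewrite -subr_eq0 -free_lift_is_zmod_morphism.
apply/eqP/free_lift_rel.
by rewrite Quotient.idealrBE reprK.
Qed.

Lemma tensor_lift_tens x m : tensor_lift (tens x m) = phi x m.
Proof. by rewrite tensor_lift_pi free_liftU. Qed.

Lemma tensor_lift_is_zmod_morphism : zmod_morphism tensor_lift.
Proof.
move=> s t; rewrite -[s]reprK -[t]reprK -pi_tensorB !tensor_lift_pi.
exact: free_lift_is_zmod_morphism.
Qed.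

End Lift.

Lemma tensor_ext (G : zmodType) (f g : {additive tensor -> G}) :
  (forall x m, f (tens x m) = g (tens x m)) -> f =1 g.
Proof.
move=> fg t; rewrite -[t]reprK [repr t]monalgE !raddf_sum.
apply: eq_bigr => -[x m] _.
have -> : << (repr t)@_(x, m) *g (x, m) >>
        = << (x, m) >> *~ (repr t)@_(x, m) :> tensor_free.
  by apply/malgP => k; rewrite raddfMz /= !mcoeffU -mulrzl intz mulr_natr.
by rewrite !raddfMz; congr (_ *~ _); exact: fg.
Qed.

End Tensor.

Section TensorMap.
Variables (R : pzRingType) (A B : rmodType R) (M N : lmodType R).
Variables (f : {linear A -> B}) (g : {linear M -> N}).

Definition tensor_map : tensor A M -> tensor B N :=
  tensor_lift (fun x m => tens (f x) (g m)).

Lemma tensor_map_balanced : balanced (fun x m => tens (f x) (g m)).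
Proof.
have [tDl tDr tZ] := tens_balanced B N.
by split=> *; rewrite ?raddfD ?linearZ ?tDl ?tDr /= ?tZ.
Qed.

HB.instance Definition _ := GRing.isZmodMorphism.Build _ _ tensor_map
  (tensor_lift_is_zmod_morphism tensor_map_balanced).

Lemma tensor_map_tens x m : tensor_map (tens x m) = tens (f x) (g m).
Proof. exact: tensor_lift_tens tensor_map_balanced x m. Qed.

End TensorMap.

Arguments tensor_map {R A B M N} f g.


(* U -f-> V -g-> W is exact at V. *)
Definition exact_at (U V W : zmodType) (f : U -> V) (g : V -> W) :=
  forall v, g v = 0 <-> exists u, f u = v.

Definition short_exact (R : pzRingType) (U V W : lmodType R)
    (f : {linear U -> V}) (g : {linear V -> W}) :=
  [/\ injective f, exact_at f g & forall w, exists v, g v = w].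

Definition projective (R : pzRingType) (P : lmodType R) :=
  forall (U V : lmodType R) (p : {linear U -> V}) (f : {linear P -> V}),
    (forall v, exists u, p u = v) -> exists h : {linear P -> U}, p \o h =1 f.

(* Also used for right modules, with S := R^c. *)
Definition injective_module (S : pzRingType) (I : lmodType S) :=
  forall (U V : lmodType S) (i : {linear U -> V}) (f : {linear U -> I}),
    injective i -> exists h : {linear V -> I}, h \o i =1 f.

(* The functor - (x)_R F is exact. *)
Definition flat (R : pzRingType) (F : lmodType R) :=
  forall (A B C : rmodType R) (f : {linear A -> B}) (g : {linear B -> C}),
    exact_at f g ->
    exact_at (tensor_map f (idfun : {linear F -> F}))
             (tensor_map g (idfun : {linear F -> F})).

(* ... -> F_1 -> F_0 -> F^0 -> F^1 -> ... with [lower n] = F_n, [upper n] = F^n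
   and [middle] : F_0 -> F^0. *)
Record biseq (R : pzRingType) := Biseq {
  lower : nat -> lmodType R;
  upper : nat -> lmodType R;
  lower_map : forall n, {linear lower n.+1 -> lower n};
  middle : {linear lower 0 -> upper 0};
  upper_map : forall n, {linear upper n -> upper n.+1}
}.

Definition biseq_exact (R : pzRingType) (F : biseq R) :=
  [/\ forall n, exact_at (lower_map F n.+1) (lower_map F n),
      exact_at (lower_map F 0) (middle F),
      exact_at (middle F) (upper_map F 0) &
      forall n, exact_at (upper_map F n) (upper_map F n.+1)].

(* The sequence I (x)_R F is exact. *)
Definition tensor_biseq_exact (R : pzRingType) (I : rmodType R) (F : biseq R) :=
  let T (M N : lmodType R) (g : {linear M -> N}) :=
    tensor_map (idfun : {linear I -> I}) g in
  [/\ forall n, exact_at (T _ _ (lower_map F n.+1)) (T _ _ (lower_map F n)),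
      exact_at (T _ _ (lower_map F 0)) (T _ _ (middle F)),
      exact_at (T _ _ (middle F)) (T _ _ (upper_map F 0)) &
      forall n, exact_at (T _ _ (upper_map F n)) (T _ _ (upper_map F n.+1))].

(* The last conjunct gives M ~ Im (F_0 -> F^0): an injective linear map
   M -> F^0 with the same image as F_0 -> F^0. *)
Definition Gorenstein_flat (R : pzRingType) (M : lmodType R) :=
  exists F : biseq R,
    [/\ (forall n, flat (lower F n)) /\ (forall n, flat (upper F n)),
        biseq_exact F,
        forall I : rmodType R, injective_module I -> tensor_biseq_exact I F &
        exists iota : {linear M -> upper F 0},
          injective iota /\
          forall y, (exists x, iota x = y) <-> (exists x, middle F x = y)].

Record projective_resolution (R : pzRingType) (M : lmodType R) :=
  ProjectiveResolution {
    res : nat -> lmodType R;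
    res_map : forall n, {linear res n.+1 -> res n};
    augmentation : {linear res 0 -> M};
    res_projective : forall n, projective (res n);
    res_exact : forall n, exact_at (res_map n.+1) (res_map n);
    augmentation_exact : exact_at (res_map 0) augmentation;
    augmentation_surj : forall m, exists p, augmentation p = m
  }.

(* Tor^R_1(I, M) = 0: the homology of I (x)_R P in degree 1 is zero, for P a
   projective resolution of M.  As Tor does not depend on the choice of P, one
   may quantify over all of them. *)
Definition Tor1_eq0 (R : pzRingType) (I : rmodType R) (M : lmodType R) :=
  forall P : projective_resolution M,
    exact_at (tensor_map (idfun : {linear I -> I}) (res_map P 1))
             (tensor_map (idfun : {linear I -> I}) (res_map P 0)).

Definition closed_under_extensions (R : pzRingType) (X : lmodType R -> Prop) :=
  forall (A B C : lmodType R) (f : {linear A -> B}) (g : {linear B -> C}),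
    short_exact f g -> X A -> X C -> X B.

Definition closed_under_kernels_of_epis (R : pzRingType)
    (X : lmodType R -> Prop) :=
  forall (A B C : lmodType R) (f : {linear A -> B}) (g : {linear B -> C}),
    short_exact f g -> X B -> X C -> X A.

Definition projectively_resolving (R : pzRingType) (X : lmodType R -> Prop) :=
  [/\ forall P : lmodType R, projective P -> X P,
      closed_under_extensions X & closed_under_kernels_of_epis X].

Definition left_GF_closed (R : pzRingType) :=
  closed_under_extensions (@Gorenstein_flat R).

(* Main.v *)
From HB Require Import structures.
Require Import Defs.
From mathcomp Require Import all_boot all_algebra.
From mathcomp Require Import finmap boolp classical_sets functions monalg.

Set Implicit Arguments.
Unset Strict Implicit.
Unset Printing Implicit Defensive.

Import GRing.Theory.
Local Open Scope ring_scope.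
Local Open Scope quotient_scope.

(** Why the three conditions agree.

    Two kinds of information determine that M is Gorenstein flat: the groups
    Tor_i(I, M) vanish for all i > 0 and all injective right modules I, and M
    has a coresolution by flat modules that stays exact under I (x) -.  A left
    half is then supplied by any free resolution of M.  All constructions below
    are therefore made with short exact sequences: a Gorenstein flat M embeds in
    a flat module with Gorenstein flat cokernel, and conversely a class of
    modules with vanishing Tor in which every member so embeds, with cokernel in
    the class, consists of Gorenstein flat modules
    ([Gorenstein_flat_cosyzygy], [Gorenstein_flat_coind]).

    Higher Tor groups do not appear.  [tor_zero I M] says that Tor_1(I, M) = 0,
    computed on the side of I; a diagram chase ([chase]) moves between this form
    and the ones computed on the side of M.  Dimension shifting is done on the
    right modules: [all_tor_zero M] asks for Tor_1(N, M) = 0 when N runs through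
    the iterated syzygies of injective modules.

    The heart of the matter is that three facts hold over every ring: the kernel
    of an epimorphism from a flat module to a Gorenstein flat one is Gorenstein
    flat ([Gorenstein_flat_kernel]); so is an extension of a flat module by a
    Gorenstein flat one ([Gorenstein_flat_extension_by_flat]); and if
    0 -> F1 -> F -> E -> 0 has F1 and F flat and Tor_1(I, E) = 0 for all
    injective I, then E is flat ([flat_of_tor_zero_injective]), because every
    right module embeds in an injective one ([enough_injectives]).

    Closure under extensions gives closure under kernels of epimorphisms and the
    condition on cokernels by completing the given sequence to a diagram whose
    further corners are extensions of Gorenstein flat modules, until one of these
    facts applies.  Conversely, an extension B of C by A is the cokernel of a
    monomorphism C' -> D between Gorenstein flat modules: take
    0 -> C' -> F -> C -> 0 with F flat and C' Gorenstein flat, and for D the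
    pullback of B and F over C, which is an extension of F by A. *)

(** * Kernels and cokernels *)

Definition additive_of (U V : zmodType) (f : U -> V) (fB : zmod_morphism f) :
    {additive U -> V} :=
  HB.pack_for {additive U -> V} f (GRing.isZmodMorphism.Build U V f fB).

Lemma linear_of (S : pzRingType) (U V : lmodType S) (f : U -> V) :
  linear f -> exists h : {linear U -> V}, h =1 f.
Proof.
move=> fL; pose F := GRing.isLinear.Build S U V *:%R f fL.
by exists (HB.pack_for {linear U -> V} f F).
Qed.

Section KernelModule.
Variables (S : pzRingType) (U V : lmodType S) (f : {linear U -> V}).

Definition ker_pred : {pred U} := fun x => f x == 0.

Lemma ker_submod_closed : submod_closed ker_pred.
Proof.
split; first by rewrite unfold_in raddf0.
move=> a u v; rewrite !unfold_in => /eqP fu /eqP fv.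
by rewrite linearP fu fv scaler0 addr0.
Qed.

HB.instance Definition _ :=
  GRing.isSubmodClosed.Build S U ker_pred ker_submod_closed.

Record ker_mod := KerMod { ker_val :> U; _ : ker_val \in ker_pred }.

HB.instance Definition _ := [isSub for ker_val].
HB.instance Definition _ := [Choice of ker_mod by <:].
HB.instance Definition _ := [SubChoice_isSubLmodule of ker_mod by <:].

End KernelModule.

Lemma ker_val_exact (S : pzRingType) (U V : lmodType S) (f : {linear U -> V}) :
  exact_at (val : ker_mod f -> U) f.
Proof.
move=> u; split=> [fu|[[v vP] /= <-]]; last exact/eqP.
by move/eqP: fu => fu; exists (KerMod (fu : u \in ker_pred f)).
Qed.

Lemma kernel_exists (S : pzRingType) (U V : lmodType S) (f : {linear U -> V}) :
  exists (K : lmodType S) (k : {linear K -> U}), injective k /\ exact_at k f.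
Proof.
exists (ker_mod f), (val : {linear ker_mod f -> U}).
by split; [exact: val_inj | exact: ker_val_exact].
Qed.

(** The quotient by a subgroup that is only known to be closed, rather than
    presented through an inferred structure. *)
Section QuotientGroup.
Variables (T : zmodType) (D : {pred T}) (DZ : zmod_closed D).

Definition closed_pred of zmod_closed D : {pred T} := D.
HB.instance Definition _ :=
  GRing.isZmodClosed.Build T (closed_pred DZ) DZ.

Definition quotg : zmodType := Quotient.quot (closed_pred DZ).

Definition quotg_pi (x : T) : quotg := \pi_quotg x.

Lemma quotg_pi_is_zmod_morphism : zmod_morphism quotg_pi.
Proof.
move=> x y; rewrite /quotg_pi.
by rewrite (@pi_addr _ _ _ _ _ (Quotient.quot (closed_pred DZ)))
           (@pi_oppr _ _ _ _ _ (Quotient.quot (closed_pred DZ))).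
Qed.
HB.instance Definition _ :=
  GRing.isZmodMorphism.Build T quotg quotg_pi quotg_pi_is_zmod_morphism.

Lemma quotg_pi_eq0 x : quotg_pi x = 0 <-> x \in D.
Proof.
have -> : x \in D = (quotg_pi x == 0).
  rewrite -(raddf0 quotg_pi) /quotg_pi.
  by rewrite -(Quotient.idealrBE (closed_pred DZ)) subr0.
by split=> /eqP.
Qed.

Lemma quotg_pi_surj y : exists x, quotg_pi x = y.
Proof. by exists (repr y); rewrite /quotg_pi reprK. Qed.

End QuotientGroup.

Section CokernelModule.
Variables (S : pzRingType) (U V : lmodType S) (f : {linear U -> V}).

Definition im_pred : {pred V} := fun v => `[< exists u, f u = v >].

Lemma im_zmod_closed : zmod_closed im_pred.
Proof.
split; first by apply/asboolP; exists 0; rewrite raddf0.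
move=> _ _ /asboolP[u <-] /asboolP[v <-].
by apply/asboolP; exists (u - v); rewrite raddfB.
Qed.

Definition coker_mod : Type := quotg im_zmod_closed.
HB.instance Definition _ := GRing.Zmodule.on coker_mod.

Local Notation piq := (quotg_pi im_zmod_closed).

Definition coker_scale (a : S) (x : coker_mod) : coker_mod :=
  piq (a *: repr x).

Lemma coker_scale_pi a v : coker_scale a (piq v) = piq (a *: v).
Proof.
apply/eqP; rewrite -subr_eq0 -raddfB; apply/eqP/quotg_pi_eq0.
rewrite -scalerBr.
have /asboolP[u fu] : repr (piq v) - v \in im_pred.
  apply/(quotg_pi_eq0 im_zmod_closed).
  by rewrite raddfB /= {1}/quotg_pi reprK subrr.
by apply/asboolP; exists (a *: u); rewrite linearZ fu.
Qed.

Let piqP (P : coker_mod -> Prop) : (forall v, P (piq v)) -> forall x, P x.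
Proof. by move=> hP x; have [v <-] := quotg_pi_surj x. Qed.

Lemma coker_scaleA a b x :
  coker_scale a (coker_scale b x) = coker_scale (a * b) x.
Proof. by elim/piqP: x => v; rewrite !coker_scale_pi scalerA. Qed.
Lemma coker_scale1 : left_id 1 coker_scale.
Proof. by elim/piqP => v; rewrite coker_scale_pi scale1r. Qed.
Lemma coker_scaleDr : right_distributive coker_scale +%R.
Proof.
move=> a; elim/piqP => u; elim/piqP => v.
by rewrite -raddfD !coker_scale_pi -raddfD scalerDr.
Qed.
Lemma coker_scaleDl x : {morph coker_scale^~ x : a b / a + b}.
Proof.
by elim/piqP: x => v a b; rewrite !coker_scale_pi -raddfD scalerDl.
Qed.
HB.instance Definition _ := GRing.Zmodule_isLmodule.Build S coker_mod
  coker_scaleA coker_scale1 coker_scaleDr coker_scaleDl.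

End CokernelModule.

Lemma cokernel_exists (S : pzRingType) (U V : lmodType S)
    (f : {linear U -> V}) :
  exists (Q : lmodType S) (q : {linear V -> Q}),
    exact_at f q /\ forall y, exists v, q v = y.
Proof.
have qL : linear (quotg_pi (im_zmod_closed f) : V -> coker_mod f).
  move=> a u v; rewrite [LHS]raddfD; congr (_ + _).
  exact/esym/coker_scale_pi.
have [q qE] := linear_of qL.
exists (coker_mod f), q; split=> [v|y].
  rewrite qE; split=> [/(quotg_pi_eq0 (im_zmod_closed f))/asboolP //|fu].
  exact/(quotg_pi_eq0 (im_zmod_closed f))/asboolP.
by have [v <-] := quotg_pi_surj y; exists v; rewrite qE.
Qed.

Lemma factor_surjective (S : pzRingType) (U Q V : lmodType S)
    (q : {linear U -> Q}) (f : {linear U -> V}) :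
  (forall y, exists u, q u = y) -> (forall u, q u = 0 -> f u = 0) ->
  exists h : {linear Q -> V}, forall u, h (q u) = f u.
Proof.
move=> /choice[s sK] qf0.
have qf u v : q u = q v -> f u = f v.
  move=> quv; apply/eqP; rewrite -subr_eq0 -raddfB; apply/eqP/qf0.
  by rewrite raddfB /= quv subrr.
have [|h hE] := @linear_of S Q V (f \o s).
  by move=> a x y /=; rewrite -linearP; apply: qf; rewrite linearP !sK.
by exists h => u; rewrite hE; apply: qf; rewrite sK.
Qed.

Lemma factor_injective (S : pzRingType) (K U V : lmodType S)
    (k : {linear K -> U}) (f : {linear V -> U}) :
  injective k -> (forall v, exists x, k x = f v) ->
  exists h : {linear V -> K}, forall v, k (h v) = f v.
Proof.
move=> kI /choice[s sK]; have [|h hE] := @linear_of S V K s.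
  by move=> a x y; apply: kI; rewrite linearP !sK linearP.
by exists h => v; rewrite hE sK.
Qed.

Lemma exact_comp0 (U V W : zmodType) (f : U -> V) (g : V -> W) u :
  exact_at f g -> g (f u) = 0.
Proof. by move=> fg; apply/fg; exists u. Qed.

Lemma injective0 (U V : zmodType) (f : {additive U -> V}) :
  (forall u, f u = 0 -> u = 0) -> injective f.
Proof.
move=> f0 u v fuv; apply/eqP; rewrite -subr_eq0; apply/eqP/f0.
by rewrite raddfB /= fuv subrr.
Qed.

Lemma injective_eq0 (U V : zmodType) (f : {additive U -> V}) u :
  injective f -> f u = 0 -> u = 0.
Proof. by move=> fI fu; apply: fI; rewrite raddf0. Qed.

(** The next two lemmas restate the previous ones at linear maps, where the
    latter would leave goals about the underlying additive map. *)
Lemma linear_injective0 (S : pzRingType) (U V : lmodType S)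
    (f : {linear U -> V}) : (forall u, f u = 0 -> u = 0) -> injective f.
Proof. exact: injective0. Qed.

Lemma linear_injective_eq0 (S : pzRingType) (U V : lmodType S)
    (f : {linear U -> V}) u : injective f -> f u = 0 -> u = 0.
Proof. exact: injective_eq0. Qed.

(** Pasting exact sequences, as when short exact sequences are joined into a
    resolution: neither an epimorphism on the left nor a monomorphism on the
    right affects exactness in the middle. *)
Lemma exact_splice (Z A B C D : zmodType) (p : Z -> A) (i : A -> B)
    (q : {additive B -> C}) (j : {additive C -> D}) :
  (forall a, exists z, p z = a) -> exact_at i q -> injective j ->
  exact_at (i \o p) (j \o q).
Proof.
move=> pS iq jI b; split=> /= [jqb|[z <-]].
  have /iq[a <-] : q b = 0 by exact: (injective_eq0 jI).
  by have [z <-] := pS a; exists z.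
by rewrite (exact_comp0 _ iq) raddf0.
Qed.

Lemma zero_module_exists (S : pzRingType) :
  exists Z : lmodType S, forall z : Z, z = 0.
Proof.
have [Z [k [kI kE]]] :=
  kernel_exists (idfun : {linear (S^o : lmodType S) -> (S^o : lmodType S)}).
by exists Z => z; apply: (linear_injective_eq0 kI); exact: (exact_comp0 z kE).
Qed.

Definition ses (S : pzRingType) (A B C : lmodType S) :=
  exists (f : {linear A -> B}) (g : {linear B -> C}), short_exact f g.

(** * Free modules *)

Section FreeModule.
Variables (S : pzRingType) (X : choiceType).

(** A copy of the finitely supported functions, to carry the scaling by a ring
    that may be zero. *)
Definition free_mod := {malg S[X]}.
HB.instance Definition _ := GRing.Zmodule.on free_mod.

Definition free_scale (a : S) (g : free_mod) : free_mod :=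
  [malg x in msupp g => a * g@_x].

Lemma free_scaleE a g x : (free_scale a g)@_x = a * g@_x.
Proof. by rewrite mcoeffE; case: msuppP => // _; rewrite mulr0. Qed.

Lemma free_scaleA a b g : free_scale a (free_scale b g) = free_scale (a * b) g.
Proof. by apply/malgP => x; rewrite !free_scaleE mulrA. Qed.
Lemma free_scale1 : left_id 1 free_scale.
Proof. by move=> g; apply/malgP => x; rewrite free_scaleE mul1r. Qed.
Lemma free_scaleDr : right_distributive free_scale +%R.
Proof.
by move=> a g h; apply/malgP => x; rewrite !(free_scaleE, mcoeffD) mulrDr.
Qed.
Lemma free_scaleDl g : {morph free_scale^~ g : a b / a + b}.
Proof.
by move=> a b; apply/malgP => x; rewrite !(free_scaleE, mcoeffD) mulrDl.
Qed.
HB.instance Definition _ := GRing.Zmodule_isLmodule.Build S free_mod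
  free_scaleA free_scale1 free_scaleDr free_scaleDl.

Definition free_gen (x : X) : free_mod := << x >>.

Lemma free_expand (g : free_mod) (d : {fset X}) :
  (msupp g `<=` d)%fset -> g = \sum_(x <- d) g@_x *: free_gen x.
Proof.
move=> /monalgEw {1}->; apply: eq_bigr => x _; apply/malgP => y.
by rewrite free_scaleE !mcoeffU mulrnAr mulr1.
Qed.

Lemma free_ext (V : lmodType S) (f h : {linear free_mod -> V}) :
  (forall x, f (free_gen x) = h (free_gen x)) -> f =1 h.
Proof.
move=> fh g; rewrite (free_expand (fsubset_refl (msupp g))) !linear_sum.
by apply: eq_bigr => x _; rewrite !linearZ /= fh.
Qed.

Lemma free_lift_exists (V : lmodType S) (v : X -> V) :
  exists f : {linear free_mod -> V}, forall x, f (free_gen x) = v x.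
Proof.
pose f (g : free_mod) := \sum_(x <- msupp g) g@_x *: v x.
have fE (g : free_mod) (d : {fset X}) : (msupp g `<=` d)%fset ->
    f g = \sum_(x <- d) g@_x *: v x.
  move=> gd; rewrite /f (big_fset_incl _ gd) // => x _ xNg.
  by rewrite mcoeff_outdom // scale0r.
have [|h hE] := @linear_of S free_mod V f.
  move=> a g h; pose d := (msupp (a *: g + h)%R `|` (msupp g `|` msupp h))%fset.
  rewrite !(fE _ d) ?fsubsetUl //; last 2 first.
  - by apply: fsubset_trans (fsubsetUr _ _); exact: fsubsetUr.
  - by apply: fsubset_trans (fsubsetUr _ _); exact: fsubsetUl.
  rewrite scaler_sumr -big_split; apply: eq_bigr => x _ /=.
  by rewrite mcoeffD free_scaleE scalerDl scalerA.
exists h => x; rewrite hE (fE _ [fset x]%fset) ?msuppU_le //.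
by rewrite big_seq_fset1 mcoeffUU scale1r.
Qed.

Lemma free_projective : projective free_mod.
Proof.
move=> U V p f pS.
have /choice[s sE] (x : X) : exists u, p u = f (free_gen x) by exact: pS.
have [h hE] := free_lift_exists s; exists h.
by apply: (free_ext (f := p \o h)) => x /=; rewrite hE sE.
Qed.

End FreeModule.

Lemma free_cover_exists (S : pzRingType) (V : lmodType S) :
  exists f : {linear free_mod S V -> V}, forall v, exists g, f g = v.
Proof.
have [f fE] := @free_lift_exists S V V id.
by exists f => v; exists (free_gen S v).
Qed.

(** * Pullbacks and pushouts of short exact sequences *)

Section PairMaps.
Variables (S : pzRingType) (A B C : lmodType S).

Lemma pair_linear (f : {linear A -> B}) (g : {linear A -> C}) :
  exists h : {linear A -> (B * C)%type}, forall a, h a = (f a, g a).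
Proof.
by apply: (@linear_of _ _ _ (fun a => (f a, g a))) => a x y; rewrite !linearP.
Qed.

Lemma copair_linear (f : {linear A -> C}) (g : {linear B -> C}) :
  exists h : {linear (A * B)%type -> C}, forall a b, h (a, b) = f a + g b.
Proof.
have [|h hE] := @linear_of _ (A * B)%type C (fun x => f x.1 + g x.2).
  by move=> a x y; rewrite /= !linearP scalerDr addrACA.
by exists h => a b; rewrite hE.
Qed.

End PairMaps.

Section Pullback.
Variables (S : pzRingType).

(** The joint injectivity of [p] and [p'] and the description of their images
    characterize the pullback symmetrically in its two projections, so that this
    lemma gives both of its exact sequences. *)
Lemma pullback_half (A B C B' D : lmodType S)
    (f : {linear A -> B}) (g : {linear B -> C}) (g' : {linear B' -> C})
    (p : {linear D -> B}) (p' : {linear D -> B'}) :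
  short_exact f g ->
  (forall d, p d = 0 -> p' d = 0 -> d = 0) ->
  (forall b b', g b = g' b' <-> exists d, p d = b /\ p' d = b') ->
  ses A D B'.
Proof.
move=> [fI fg gS] joint pE.
have /choice[s sP] a : exists d, p d = f a /\ p' d = 0.
  by apply/pE; rewrite (exact_comp0 _ fg) raddf0.
have [|i iE] := @linear_of S A D s.
  move=> a x y; apply/eqP; rewrite -subr_eq0; apply/eqP.
  have [[px p'x] [py p'y]] := (sP x, sP y).
  have [pxy p'xy] := sP (a *: x + y).
  apply: joint; rewrite linearB linearP.
    by rewrite pxy px py linearP subrr.
  by rewrite p'xy p'x p'y scaler0 addr0 subrr.
exists i, p'; split.
- apply: linear_injective0 => a ia; have := (sP a).1; rewrite -iE ia linear0.
  by move=> /esym; exact: linear_injective_eq0.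
- move=> d; split=> [p'd|[a <-]]; last by rewrite iE (sP a).2.
  have gpd : g (p d) = 0.
    by have /pE -> : exists e, p e = p d /\ p' e = 0;
      [exists d | rewrite raddf0].
  have [a fa] := (fg (p d)).1 gpd; exists a; rewrite iE.
  apply/eqP; rewrite -subr_eq0; apply/eqP; apply: joint; rewrite linearB.
    by rewrite (sP a).1 fa subrr.
  by rewrite (sP a).2 p'd subrr.
- move=> b'; have [b gb] := gS (g' b').
  by have [d [_ <-]] := (pE b b').1 gb; exists d.
Qed.

Lemma pullback_ses (A B C A' B' : lmodType S)
    (f : {linear A -> B}) (g : {linear B -> C})
    (f' : {linear A' -> B'}) (g' : {linear B' -> C}) :
  short_exact f g -> short_exact f' g' ->
  exists D : lmodType S, ses A D B' /\ ses A' D B.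
Proof.
move=> fg fg'; have [h hE] := copair_linear g (\- g' : {linear B' -> C}).
have [D [k [kI kh]]] := kernel_exists h.
pose p : {linear D -> B} := fst \o k; pose p' : {linear D -> B'} := snd \o k.
have joint d : p d = 0 -> p' d = 0 -> d = 0.
  rewrite /p /p' /= => pd p'd; apply: (linear_injective_eq0 kI).
  by rewrite [LHS]surjective_pairing; congr (_, _).
have pE b b' : g b = g' b' <-> exists d, p d = b /\ p' d = b'.
  split=> [gb|[d [<- <-]]].
    have /kh[d kd] : h (b, b') = 0 by rewrite hE /= gb subrr.
    by exists d; rewrite /p /p' /= kd.
  apply/eqP; rewrite -subr_eq0 -[_ - _]/(g (p d) + (\- g') (p' d)) -hE.
  by rewrite -[(_, _)]surjective_pairing (exact_comp0 _ kh).
exists D; split; first exact: pullback_half fg joint pE.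
apply: pullback_half fg' (fun d x y => joint d y x) _ => b' b.
split=> [/esym/pE[d [<- <-]]|[d [<- <-]]]; first by exists d.
by apply/esym/pE; exists d.
Qed.

End Pullback.

Section Pushout.
Variables (S : pzRingType).

(** Dually to the case of pullbacks, joint surjectivity and the relations between
    the two images characterize the pushout symmetrically. *)
Lemma pushout_half (A B B' C' D : lmodType S)
    (f : {linear A -> B}) (f' : {linear A -> B'}) (g' : {linear B' -> C'})
    (i : {linear B -> D}) (i' : {linear B' -> D}) :
  short_exact f' g' ->
  (forall d, exists b b', i b + i' b' = d) ->
  (forall b b', i b = i' b' <-> exists a, f a = b /\ f' a = b') ->
  ses B D C'.
Proof.
move=> [f'I fg' g'S] joint iE.
have [h hE] := copair_linear i i'.
have hS d : exists x, h x = d.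
  by have [b [b' <-]] := joint d; exists (b, b'); rewrite hE.
have h0 x : h x = 0 -> (g' \o snd) x = 0.
  case: x => b b'; rewrite hE => /eqP; rewrite addr_eq0 -linearN => /eqP/iE.
  move=> [a [_ fa]] /=; apply: oppr_inj; rewrite -linearN -fa oppr0.
  exact: exact_comp0 fg'.
have [p pE] := factor_surjective hS h0.
have pE2 b b' : p (i b + i' b') = g' b' by rewrite -hE pE.
exists i, p; split.
- apply: linear_injective0 => b ib.
  have /iE[a [<-]] : i b = i' 0 by rewrite linear0.
  by move=> /(linear_injective_eq0 f'I) ->; rewrite linear0.
- move=> d; have [b [b' <-]] := joint d; rewrite pE2.
  split=> [/fg'[a <-]|[b1 ib1]].
    exists (b + f a); rewrite linearD; congr (_ + _).
    by apply/iE; exists a.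
  by rewrite -(pE2 b b') -ib1 -[i b1]addr0 -(linear0 i') pE2 linear0.
- move=> c; have [b' <-] := g'S c; exists (i 0 + i' b').
  by rewrite pE2.
Qed.

Lemma pushout_ses (A B C B' C' : lmodType S)
    (f : {linear A -> B}) (g : {linear B -> C})
    (f' : {linear A -> B'}) (g' : {linear B' -> C'}) :
  short_exact f g -> short_exact f' g' ->
  exists D : lmodType S, ses B D C' /\ ses B' D C.
Proof.
move=> fg fg'; have [h hE] := pair_linear f (\- f' : {linear A -> B'}).
have [D [q [hq qS]]] := cokernel_exists h.
have [in1 in1E] :=
  pair_linear (idfun : {linear B -> B}) (GRing.null_fun _ : {linear B -> B'}).
have [in2 in2E] :=
  pair_linear (GRing.null_fun _ : {linear B' -> B}) (idfun : {linear B' -> B'}).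
pose i : {linear B -> D} := q \o in1; pose i' : {linear B' -> D} := q \o in2.
have iE b b' : i b + i' b' = q (b, b').
  rewrite /i /i' /= -linearD in1E in2E; congr (q _).
  by congr (_, _); rewrite /= ?addr0 ?add0r.
have joint d : exists b b', i b + i' b' = d.
  by have [[b b'] <-] := qS d; exists b, b'.
have eqE b b' : i b = i' b' <-> exists a, f a = b /\ f' a = b'.
  have -> : i b = i' b' <-> q (b, - b') = 0.
    by rewrite -iE linearN; split=> [->|/subr0_eq //]; rewrite subrr.
  split=> [/hq[a]|[a [<- <-]]]; last by apply/hq; exists a; rewrite hE.
  by rewrite hE => -[fa /oppr_inj f'a]; exists a.
exists D; split; first exact: pushout_half fg' joint eqE.
apply: pushout_half fg _ _ => [d|b' b].
  by have [b [b' <-]] := joint d; exists b', b; rewrite addrC.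
split=> [/esym/eqE[a [<- <-]]|[a [<- <-]]]; first by exists a.
by apply/esym/eqE; exists a.
Qed.

End Pushout.

(** The third isomorphism theorem: for A <= B <= X, the quotient X / A is an
    extension of X / B by B / A. *)
Lemma quotient_ses (S : pzRingType) (A B C X G : lmodType S)
    (f : {linear A -> B}) (g : {linear B -> C})
    (k : {linear B -> X}) (h : {linear X -> G}) :
  short_exact f g -> short_exact k h ->
  exists E : lmodType S, ses A X E /\ ses C E G.
Proof.
move=> [fI fg gS] [kI kh hS].
have [E [q [fq qS]]] := cokernel_exists (k \o f : {linear A -> X}).
have [|i iE] := @factor_surjective S B C E g (q \o k) gS.
  by move=> b /fg[a <-]; apply/fq; exists a.
have [|p pE] := @factor_surjective S X E G q h qS.
  by move=> x /fq[a <-]; exact: exact_comp0 kh.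
exists E; split.
  by exists (k \o f), q; split=> //; exact: inj_comp.
exists i, p; split.
- apply: linear_injective0 => c; have [b <-] := gS c.
  by rewrite iE => /fq[a /kI <-]; exact: exact_comp0 fg.
- move=> e; have [x <-] := qS e; rewrite pE.
  split=> [/kh[b <-]|[c]]; first by exists (g b); rewrite iE.
  have [b <-] := gS c; rewrite iE /= -(pE x) => <-.
  by rewrite pE; exact: exact_comp0 kh.
- by move=> y; have [x <-] := hS y; exists (q x); rewrite pE.
Qed.

(** * Tensor products *)

Local Notation tmapl f M := (tensor_map f (idfun : {linear M -> M})).
Local Notation tmapr A g := (tensor_map (idfun : {linear A -> A}) g).

Section TensorFacts.
Variables (R : pzRingType).

Lemma tensor_gen (A : rmodType R) (M : lmodType R) (D : {pred tensor A M}) :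
  zmod_closed D -> (forall x m, tens x m \in D) -> forall t, t \in D.
Proof.
move=> DZ tD t; apply/(quotg_pi_eq0 DZ).
pose f : {additive tensor A M -> quotg DZ} := quotg_pi DZ.
pose g : {additive tensor A M -> quotg DZ} := GRing.null_fun _.
rewrite -[LHS]/(f t) (@tensor_ext _ _ _ _ f g) // => x m.
exact/quotg_pi_eq0.
Qed.

Lemma tensor_mapE (A B B' C : rmodType R) (M N N' P : lmodType R)
    (f1 : {linear A -> B}) (g1 : {linear M -> N})
    (f2 : {linear B -> C}) (g2 : {linear N -> P})
    (f3 : {linear A -> B'}) (g3 : {linear M -> N'})
    (f4 : {linear B' -> C}) (g4 : {linear N' -> P}) :
  (forall x, f2 (f1 x) = f4 (f3 x)) -> (forall m, g2 (g1 m) = g4 (g3 m)) ->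
  forall t, tensor_map f2 g2 (tensor_map f1 g1 t) =
            tensor_map f4 g4 (tensor_map f3 g3 t).
Proof.
move=> fE gE.
apply: (@tensor_ext _ _ _ _ (tensor_map f2 g2 \o tensor_map f1 g1)
  (tensor_map f4 g4 \o tensor_map f3 g3)) => x m /=.
by rewrite !tensor_map_tens fE gE.
Qed.

Lemma tensor_map_comp (A B C : rmodType R) (M N P : lmodType R)
    (f1 : {linear A -> B}) (g1 : {linear M -> N})
    (f2 : {linear B -> C}) (g2 : {linear N -> P})
    (f : {linear A -> C}) (g : {linear M -> P}) :
  (forall x, f2 (f1 x) = f x) -> (forall m, g2 (g1 m) = g m) ->
  forall t, tensor_map f2 g2 (tensor_map f1 g1 t) = tensor_map f g t.
Proof.
move=> fE gE.
apply: (@tensor_ext _ _ _ _ (tensor_map f2 g2 \o tensor_map f1 g1)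
  (tensor_map f g)) => x m /=.
by rewrite !tensor_map_tens fE gE.
Qed.

Lemma tensor_map_swap (A B : rmodType R) (M N : lmodType R)
    (f : {linear A -> B}) (g : {linear M -> N}) t :
  tmapr B g (tmapl f M t) = tmapl f N (tmapr A g t).
Proof. exact: tensor_mapE. Qed.

Lemma tens0l (A : rmodType R) (M : lmodType R) m :
  tens (0 : A) m = 0 :> tensor A M.
Proof.
have [tD _ _] := tens_balanced A M.
by apply: (addrI (tens 0 m)); rewrite -tD !addr0.
Qed.

Lemma tens0r (A : rmodType R) (M : lmodType R) x :
  tens x (0 : M) = 0 :> tensor A M.
Proof.
have [_ tD _] := tens_balanced A M.
by apply: (addrI (tens x 0)); rewrite -tD !addr0.
Qed.

Lemma tensor_map_id (A : rmodType R) (M : lmodType R)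
    (f : {linear A -> A}) (g : {linear M -> M}) :
  f =1 id -> g =1 id -> tensor_map f g =1 id.
Proof.
move=> fE gE; apply: (@tensor_ext _ _ _ _ (tensor_map f g) idfun) => x m /=.
by rewrite tensor_map_tens fE gE.
Qed.

Lemma tensor_map0 (A B : rmodType R) (M N : lmodType R)
    (f : {linear A -> B}) (g : {linear M -> N}) :
  (forall x, f x = 0) \/ (forall m, g m = 0) -> forall t, tensor_map f g t = 0.
Proof.
move=> fg0.
apply: (@tensor_ext _ _ _ _ (tensor_map f g) (GRing.null_fun _)) => x m /=.
by case: fg0 => h; rewrite tensor_map_tens h (tens0l, tens0r).
Qed.

Lemma tensor_map_surj (A B : rmodType R) (M N : lmodType R)
    (f : {linear A -> B}) (g : {linear M -> N}) :
  (forall y, exists x, f x = y) -> (forall n, exists m, g m = n) ->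
  forall t, exists s, tensor_map f g s = t.
Proof.
move=> fS gS t; apply/asboolP.
apply: (@tensor_gen _ _ (fun t => `[< exists s, tensor_map f g s = t >])).
  split=> [|_ _ /asboolP[s <-] /asboolP[s' <-]]; apply/asboolP.
    by exists 0; rewrite raddf0.
  by exists (s - s'); rewrite raddfB.
move=> y n; apply/asboolP; have [[x <-] [m <-]] := (fS y, gS n).
by exists (tens x m); rewrite tensor_map_tens.
Qed.

(** Right exactness in both variables at once: B (x) N is A (x) M modulo the
    tensors that obviously die.  An inverse of the map induced on that quotient
    sends y (x) n to the class of x (x) m for any preimages x and m. *)
Lemma tensor_map_ker (A B : rmodType R) (M N : lmodType R)
    (f : {linear A -> B}) (g : {linear M -> N}) (D : {pred tensor A M}) :
  (forall y, exists x, f x = y) -> (forall n, exists m, g m = n) ->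
  zmod_closed D -> (forall x m, f x = 0 \/ g m = 0 -> tens x m \in D) ->
  forall t, tensor_map f g t = 0 -> t \in D.
Proof.
move=> /choice[s sK] /choice[r rK] DZ fgD t ft0.
have [tDl tDr tZ] := tens_balanced A M.
pose pi : {additive tensor A M -> quotg DZ} := quotg_pi DZ.
have piE x m x' m' :
    f x = f x' -> g m = g m' -> pi (tens x m) = pi (tens x' m').
  move=> fx gm; rewrite -[x](subrK x') tDl -[in tens x' _](subrK m' m) tDr.
  have D1 : pi (tens (x - x') m) = 0.
    by apply/quotg_pi_eq0/fgD; left; rewrite linearB fx subrr.
  have D2 : pi (tens x' (m - m')) = 0.
    by apply/quotg_pi_eq0/fgD; right; rewrite linearB gm subrr.
  by rewrite !raddfD /= D1 D2 !add0r.
pose phi y n := pi (tens (s y) (r n)).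
have phi_bal : balanced phi.
  rewrite /phi; split=> [y y' n|y n n'|y a n].
  - by rewrite -raddfD -tDl; apply: piE; rewrite ?linearD ?sK ?rK.
  - by rewrite -raddfD -tDr; apply: piE; rewrite ?linearD ?sK ?rK.
  - rewrite (piE _ _ ((a : R^c) *: s y) (r n)) ?linearZ ?sK ?rK // tZ.
    by apply: piE; rewrite ?linearZ ?sK ?rK.
pose psi : {additive tensor B N -> quotg DZ} :=
  additive_of (tensor_lift_is_zmod_morphism phi_bal).
have psiE : psi \o tensor_map f g =1 pi.
  apply: (@tensor_ext _ _ _ _ (psi \o tensor_map f g) pi) => x m /=.
  rewrite tensor_map_tens [LHS](tensor_lift_tens phi_bal).
  by apply: piE; rewrite ?sK ?rK.
apply/(quotg_pi_eq0 DZ); rewrite -[LHS](psiE t) /= ft0; exact: (raddf0 psi).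
Qed.

Lemma tensor_right_exactl (A B C : rmodType R) (M : lmodType R)
    (f : {linear A -> B}) (g : {linear B -> C}) :
  exact_at f g -> (forall y, exists x, g x = y) ->
  exact_at (tmapl f M) (tmapl g M).
Proof.
move=> fg gS t; split=> [gt|[s <-]]; last first.
  rewrite (tensor_map_comp (f := g \o f) (g := idfun)) // tensor_map0 //.
  by left=> x /=; exact: exact_comp0 fg.
apply/asboolP.
apply: (tensor_map_ker (D := fun t => `[< exists u, tmapl f M u = t >])
  _ _ _ _ gt).
- exact: gS.
- by move=> n; exists n.
- split=> [|_ _ /asboolP[s <-] /asboolP[s' <-]]; apply/asboolP.
    by exists 0; rewrite raddf0.
  by exists (s - s'); rewrite raddfB.
- move=> x m gxm; apply/asboolP; case: gxm => [/fg[y <-]|/= ->].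
    by exists (tens y m); rewrite tensor_map_tens.
  by exists 0; rewrite raddf0 tens0r.
Qed.

Lemma tensor_right_exactr (A : rmodType R) (M N P : lmodType R)
    (f : {linear M -> N}) (g : {linear N -> P}) :
  exact_at f g -> (forall y, exists x, g x = y) ->
  exact_at (tmapr A f) (tmapr A g).
Proof.
move=> fg gS t; split=> [gt|[s <-]]; last first.
  rewrite (tensor_map_comp (f := idfun) (g := g \o f)) // tensor_map0 //.
  by right=> x /=; exact: exact_comp0 fg.
apply/asboolP.
apply: (tensor_map_ker (D := fun t => `[< exists u, tmapr A f u = t >])
  _ _ _ _ gt).
- by move=> n; exists n.
- exact: gS.
- split=> [|_ _ /asboolP[s <-] /asboolP[s' <-]]; apply/asboolP.
    by exists 0; rewrite raddf0.
  by exists (s - s'); rewrite raddfB.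
- move=> x m gxm; apply/asboolP; case: gxm => [/= ->|/fg[y <-]].
    by exists 0; rewrite raddf0 tens0l.
  by exists (tens x y); rewrite tensor_map_tens.
Qed.

End TensorFacts.

(** * Flatness and the vanishing of Tor_1 *)

Section Flatness.
Variables (R : pzRingType).

Lemma flat_tensor_injective (F : lmodType R) (A B : rmodType R)
    (f : {linear A -> B}) :
  flat F -> injective f -> injective (tmapl f F).
Proof.
move=> Ff fI; have [Z Z0] := zero_module_exists (R^c).
pose z : {linear Z -> A} := GRing.null_fun _.
have /Ff ex : exact_at z f.
  move=> x; split=> [/(linear_injective_eq0 fI) ->|[y <-]]; first by exists 0.
  by rewrite /z /= linear0.
apply: injective0 => t /ex[s <-]; apply: tensor_map0; by left.
Qed.

(** Tensoring being right exact, only monomorphisms can be an obstruction: an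
    exact pair [f], [g] factors through the cokernel of [f], which [g] embeds in
    its target. *)
Lemma flat_of_injective (F : lmodType R) :
  (forall (A B : rmodType R) (f : {linear A -> B}),
     injective f -> injective (tmapl f F)) -> flat F.
Proof.
move=> FI A B C f g fg; have [Q [q [fq qS]]] := cokernel_exists f.
have [|j jE] := @factor_surjective _ B Q C q g qS.
  by move=> b /fq[a <-]; exact: exact_comp0 fg.
have jI : injective j.
  apply: linear_injective0 => y; have [b <-] := qS y.
  by rewrite jE => /fg gb; apply/fq.
have ex := tensor_right_exactl (M := F) fq qS.
have jqE t : tmapl g F t = tmapl j F (tmapl q F t).
  by symmetry; apply: tensor_map_comp.
move=> t; rewrite jqE; split=> [|[s <-]].
  by move=> /(injective_eq0 (FI _ _ _ jI)) /ex.
by rewrite (exact_comp0 _ ex) raddf0.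
Qed.

(** Flatness of a right module, in the form in which it is used. *)
Definition right_flat (P : rmodType R) :=
  forall (M N : lmodType R) (f : {linear M -> N}),
    injective f -> injective (tmapr P f).

(** Coordinates [c] with values in [G] determine a tensor as soon as every pure
    tensor can be rebuilt from them; the sum ranges over all large enough finite
    sets so that this property passes to differences of tensors. *)
Lemma tensor_coordinates (A : rmodType R) (M : lmodType R) (G : zmodType)
    (X : choiceType) (ins : X -> {additive G -> tensor A M})
    (c : X -> {additive tensor A M -> G}) :
  (forall a m, exists d : {fset X}, forall e, (d `<=` e)%fset ->
     tens a m = \sum_(x <- e) ins x (c x (tens a m))) ->
  forall t, (forall x, c x t = 0) -> t = 0.
Proof.
move=> tensE t ct0; pose D := fun t : tensor A M => `[< exists d : {fset X},
  forall e, (d `<=` e)%fset -> t = \sum_(x <- e) ins x (c x t) >].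
suff /asboolP[d tE] : t \in D.
  by rewrite (tE d) ?fsubset_refl // big1 // => x _; rewrite ct0 raddf0.
apply: (@tensor_gen R A M D) => [|a m]; last exact/asboolP/tensE.
split=> [|u v /asboolP[d uE] /asboolP[d' vE]]; apply/asboolP.
  by exists fset0 => e _; rewrite big1 // => x _; rewrite !raddf0.
exists (d `|` d')%fset => e de; rewrite {1}(uE e) 1?{1}(vE e).
- by rewrite -sumrB; apply: eq_bigr => x _; rewrite !raddfB.
- exact: fsubset_trans (fsubsetUr _ _) de.
- exact: fsubset_trans (fsubsetUl _ _) de.
Qed.

(** The coordinate at [x] of p (x) m is p_x m, and these are natural in [M]. *)
Lemma free_right_flat (X : choiceType) : right_flat (free_mod R^c X).
Proof.
pose P := free_mod R^c X.
pose phi (M : lmodType R) (x : X) (p : P) (m : M) := (p@_x : R) *: m.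
have phi_bal (M : lmodType R) x : balanced (phi M x).
  split=> [p q m|p m n|p a m]; rewrite /phi.
  - by rewrite mcoeffD scalerDl.
  - by rewrite scalerDr.
  - by rewrite free_scaleE scalerA.
pose c M x := additive_of (tensor_lift_is_zmod_morphism (phi_bal M x)).
have cE M x p m : c M x (tens p m) = phi M x p m by exact: tensor_lift_tens.
move=> M N f fI; apply: injective0 => t ft0.
have [tDl tDr tZ] := tens_balanced P M.
have tB x : zmod_morphism (tens (free_gen R^c x : P) : M -> tensor P M).
  by move=> m n; apply/eqP; rewrite eq_sym subr_eq -tDr subrK.
pose ins x := additive_of (tB x).
apply: (tensor_coordinates (ins := ins) (c := c M)) => [p m|x].
  exists (msupp p) => e pe; rewrite {1}(free_expand pe).
  rewrite (big_morph (fun q => tens q m) (fun q q' => tDl q q' m) (tens0l _ m)).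
  by apply: eq_bigr => x _; rewrite tZ cE.
have cN : f \o c M x =1 c N x \o tmapr P f.
  apply: (@tensor_ext _ _ _ _ (f \o c M x) (c N x \o tmapr P f)) => p m /=.
  by rewrite tensor_map_tens !(tensor_lift_tens (phi_bal _ x)) /phi linearZ.
apply: (linear_injective_eq0 fI); rewrite -[LHS]/((f \o c M x) t) cN /= ft0.
exact: (raddf0 (c _ x)).
Qed.

Lemma free_flat (X : choiceType) : flat (free_mod R X).
Proof.
pose P := free_mod R X.
pose phi (A : rmodType R) (x : X) (a : A) (p : P) := (p@_x : R^c) *: a.
have phi_bal (A : rmodType R) x : balanced (phi A x).
  split=> [a b p|a p q|a r p]; rewrite /phi.
  - by rewrite scalerDr.
  - by rewrite mcoeffD scalerDl.
  - by rewrite free_scaleE scalerA.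
pose c A x := additive_of (tensor_lift_is_zmod_morphism (phi_bal A x)).
have cE A x a p : c A x (tens a p) = phi A x a p by exact: tensor_lift_tens.
apply: flat_of_injective => A B f fI; apply: injective0 => t ft0.
have [tDl tDr tZ] := tens_balanced A P.
have tB x : zmod_morphism (fun a : A => tens a (free_gen R x : P)).
  by move=> a b; apply/eqP; rewrite eq_sym subr_eq -tDl subrK.
pose ins x := additive_of (tB x).
apply: (tensor_coordinates (ins := ins) (c := c A)) => [a p|x].
  exists (msupp p) => e pe; rewrite {1}(free_expand pe).
  rewrite (big_morph (tens a) (tDr a) (tens0r _ a)).
  by apply: eq_bigr => x _; rewrite cE; exact: esym (tZ a p@_x _).
have cN : f \o c A x =1 c B x \o tmapl f P.
  apply: (@tensor_ext _ _ _ _ (f \o c A x) (c B x \o tmapl f P)) => a p /=.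
  by rewrite tensor_map_tens !(tensor_lift_tens (phi_bal _ x)) /phi linearZ.
apply: (linear_injective_eq0 fI); rewrite -[LHS]/((f \o c A x) t) cN /= ft0.
exact: (raddf0 (c _ x)).
Qed.

(** A projective module is a retract of a free one, and flatness passes to
    retracts. *)
Lemma projective_flat (P : lmodType R) : projective P -> flat P.
Proof.
move=> Pproj; have [p pS] := free_cover_exists P.
have [s sK] := Pproj _ _ p idfun pS.
apply: flat_of_injective => A B f fI; apply: injective0 => t ft0.
have sI : tmapr A s t = 0.
  apply: (injective_eq0 (flat_tensor_injective (@free_flat P) fI)).
  by apply: (etrans (esym (tensor_map_swap f s t))); rewrite ft0 raddf0.
have <- : tmapr A p (tmapr A s t) = t.
  by rewrite (tensor_map_comp (f := idfun) (g := idfun)) // tensor_map_id.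
by rewrite sI raddf0.
Qed.

(** The diagram chase behind the balancing of Tor.  The groups form a three by
    three diagram, with rows N, P, I and columns K, X, M, that is right exact in
    both directions.  It is used for such a diagram and for its transpose. *)
Lemma chase (NK NX NM PK PX PM IK IX : zmodType)
    (a1 : {additive NK -> NX}) (b1 : {additive NX -> NM})
    (a2 : {additive PK -> PX}) (b2 : {additive PX -> PM})
    (a3 : {additive IK -> IX})
    (u1 : {additive NK -> PK}) (v1 : {additive PK -> IK})
    (u2 : {additive NX -> PX}) (v2 : {additive PX -> IX})
    (u3 : {additive NM -> PM}) :
  (forall y, exists x, v1 x = y) -> exact_at u1 v1 -> exact_at u2 v2 ->
  exact_at a1 b1 -> exact_at a2 b2 ->
  (forall x, a2 (u1 x) = u2 (a1 x)) -> (forall x, a3 (v1 x) = v2 (a2 x)) ->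
  (forall x, u3 (b1 x) = b2 (u2 x)) ->
  injective a2 -> injective u3 -> injective a3.
Proof.
move=> v1S ex1 ex2 exN exP sq1 sq2 sq3 a2I u3I; apply: injective0 => t a3t.
have [u ut] := v1S t; have /ex2[x xu] : v2 (a2 u) = 0 by rewrite -sq2 ut.
have /exN[w wx] : b1 x = 0.
  by apply: (injective_eq0 u3I); rewrite sq3 xu (exact_comp0 _ exP).
by rewrite -ut -(a2I (u1 w) u) ?(exact_comp0 _ ex1) // sq1 wx.
Qed.

End Flatness.

(** * Free resolutions *)

Section Syzygies.
Variables (S : pzRingType).

Definition free_cover (M : lmodType S) : {linear free_mod S M -> M} :=
  projT1 (cid (free_cover_exists M)).

Lemma free_cover_surj (M : lmodType S) m : exists g, free_cover M g = m.
Proof. by rewrite /free_cover; case: cid. Qed.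

Definition syzygy1 (M : lmodType S) : lmodType S := ker_mod (free_cover M).

Definition syzygy1_incl (M : lmodType S) :
  {linear syzygy1 M -> free_mod S M} := val.

Lemma syzygy1_exact (M : lmodType S) :
  short_exact (syzygy1_incl M) (free_cover M).
Proof.
split; [exact: val_inj | exact: ker_val_exact | exact: free_cover_surj].
Qed.

Fixpoint syzygy (M : lmodType S) n : lmodType S :=
  if n is n'.+1 then syzygy1 (syzygy M n') else M.

Definition syzygy_map (M : lmodType S) n :
    {linear free_mod S (syzygy M n.+1) -> free_mod S (syzygy M n)} :=
  syzygy1_incl (syzygy M n) \o free_cover (syzygy M n.+1).

Lemma syzygy_map_exact (M : lmodType S) n :
  exact_at (syzygy_map M n.+1) (syzygy_map M n).
Proof.
have [_ ex _] := syzygy1_exact (syzygy M n.+1).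
have [vI _ _] := syzygy1_exact (syzygy M n).
exact: exact_splice (@free_cover_surj _) ex vI.
Qed.

Lemma free_cover_exact (M : lmodType S) :
  exact_at (syzygy_map M 0) (free_cover M).
Proof.
have [_ ex _] := syzygy1_exact M.
exact: (exact_splice (j := idfun) (@free_cover_surj _) ex (fun x y => id)).
Qed.

Definition free_resolution (M : lmodType S) : projective_resolution M :=
  ProjectiveResolution (fun n => @free_projective S (syzygy M n))
    (@syzygy_map_exact M) (@free_cover_exact M) (@free_cover_surj M).

End Syzygies.

(** * Vanishing of Tor_1 *)

Section TorVanishing.
Variables (R : pzRingType).
Implicit Types (I N P : rmodType R) (A B C F K M X : lmodType R).

(** Tor_1(I, M) = 0, computed on the side of [I].  Quantifying over all
    presentations of [I] rather than the flat ones is harmless, since a single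
    flat one decides ([tor_zero_of_right_flat_cover]). *)
Definition tor_zero I M :=
  forall N P (i : {linear N -> P}) (p : {linear P -> I}),
    short_exact i p -> injective (tmapl i M).

Lemma flat_cover_exists M :
  exists K F (k : {linear K -> F}) (q : {linear F -> M}),
    flat F /\ short_exact k q.
Proof.
exists (syzygy1 M), (free_mod R M), (syzygy1_incl M), (free_cover M).
by split; [exact: free_flat | exact: syzygy1_exact].
Qed.

Lemma flat_tor_zero F I : flat F -> tor_zero I F.
Proof. by move=> Ff N P i p [iI _ _]; exact: flat_tensor_injective. Qed.

Lemma flat_of_tor_zero F : (forall I, tor_zero I F) -> flat F.
Proof.
move=> torF; apply: flat_of_injective => A B f fI.
have [Q [q [fq qS]]] := cokernel_exists f.
by apply: (torF Q _ _ f q).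
Qed.

(** Balancing: a single flat presentation of [I], for which Tor_1(I, M) = 0 is
    seen on the side of [I], decides about all short exact sequences that end in
    [M]. *)
Lemma balance_left I N P M K X (i : {linear N -> P}) (p : {linear P -> I})
    (k : {linear K -> X}) (q : {linear X -> M}) :
  short_exact i p -> right_flat P -> injective (tmapl i M) ->
  short_exact k q -> injective (tmapr I k).
Proof.
move=> [_ ip pS] Pf uI [kI kq qS].
apply: (chase _ (tensor_right_exactl (M := K) ip pS)
  (tensor_right_exactl (M := X) ip pS) (tensor_right_exactr (A := N) kq qS)
  (tensor_right_exactr (A := P) kq qS)); last exact: uI.
- by apply: tensor_map_surj => // y; exists y.
- exact: tensor_map_swap.
- exact: tensor_map_swap.
- by move=> t; apply: esym; exact: tensor_map_swap.
- exact: Pf.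
Qed.

(** Balancing in the other direction, by transposing the chase. *)
Lemma tor_zero_of_flat_cover I M K F
    (k : {linear K -> F}) (q : {linear F -> M}) :
  flat F -> short_exact k q -> injective (tmapr I k) -> tor_zero I M.
Proof.
move=> Ff [kI kq qS] IkI N P i p [iI ip pS].
apply: (chase _ (tensor_right_exactr (A := N) kq qS)
  (tensor_right_exactr (A := P) kq qS) (tensor_right_exactl (M := K) ip pS)
  (tensor_right_exactl (M := F) ip pS)); last exact: IkI.
- by apply: tensor_map_surj => // y; exists y.
- by move=> t; apply: esym; exact: tensor_map_swap.
- by move=> t; apply: esym; exact: tensor_map_swap.
- exact: tensor_map_swap.
- exact: flat_tensor_injective.
Qed.

(** Balancing forth and back. *)
Lemma tor_zero_of_right_flat_cover I N P M
    (i : {linear N -> P}) (p : {linear P -> I}) :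
  short_exact i p -> right_flat P -> injective (tmapl i M) -> tor_zero I M.
Proof.
move=> ip Pf iMI; have kq := syzygy1_exact M.
exact: tor_zero_of_flat_cover (@free_flat R M) kq (balance_left ip Pf iMI kq).
Qed.

Lemma tor_zero_injective I M K X (k : {linear K -> X}) (q : {linear X -> M}) :
  tor_zero I M -> short_exact k q -> injective (tmapr I k).
Proof.
move=> torM kq; have ip := syzygy1_exact I.
exact: balance_left ip (@free_right_flat R I) (torM _ _ _ _ ip) kq.
Qed.

(** Let X be a flat module mapping onto B with kernel K, and let X' be the
    preimage of A in X.  The inclusion of K in X is the composite of those of K
    in X' and of X' in X, whose cokernels A and C have vanishing Tor, so that
    both remain injective after tensoring. *)
Lemma tor_zero_extension I A B C (f : {linear A -> B}) (g : {linear B -> C}) :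
  short_exact f g -> tor_zero I A -> tor_zero I C -> tor_zero I B.
Proof.
move=> [fI fg gS] torA torC.
have [K [X [k [p [Xf kp]]]]] := flat_cover_exists B.
apply: (tor_zero_of_flat_cover Xf kp); have [kI kp0 pS] := kp.
have [X' [j [jI jgp]]] := kernel_exists (g \o p : {linear X -> C}).
have [|p' p'E] := @factor_injective _ A B X' f (p \o j) fI.
  by move=> x; apply/fg; exact: (exact_comp0 x jgp).
have [|k' k'E] := @factor_injective _ X' X K j k jI.
  by move=> x; apply/jgp => /=; rewrite (exact_comp0 _ kp0) linear0.
have ex1 : short_exact k' p'.
  split.
  - by move=> x y /(congr1 j); rewrite !k'E => /kI.
  - move=> x; split=> [p'x|[y <-]].
      have /kp0[y ky] : p (j x) = 0 by rewrite -[LHS]p'E p'x linear0.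
      by exists y; apply: jI; rewrite k'E.
    by apply: fI; rewrite p'E /= k'E (exact_comp0 _ kp0) linear0.
  - move=> a; have [x px] := pS (f a).
    have /jgp[x' jx'] : (g \o p) x = 0 by rewrite /= px (exact_comp0 _ fg).
    by exists x'; apply: fI; rewrite p'E /= jx'.
have ex2 : short_exact j (g \o p).
  split=> // c; have [b <-] := gS c; have [x <-] := pS b; by exists x.
have k1I := tor_zero_injective torA ex1.
have jI' := tor_zero_injective torC ex2.
have kE t : tmapr I j (tmapr I k' t) = tmapr I k t by exact: tensor_map_comp.
by move=> s t st; apply/k1I/jI'; rewrite [LHS]kE st -[LHS]kE.
Qed.

(** With K the image of P_1 -> P_0, right exactness identifies the homology of
    I (x) P in degree 1 with the kernel of I (x) K -> I (x) P_0. *)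
Lemma Tor1_eq0_tor_zero I M : Tor1_eq0 I M -> tor_zero I M.
Proof.
move=> /(_ (free_resolution M)) /= exI.
have ex0 := syzygy1_exact M; have [_ ex1 _] := syzygy1_exact (syzygy1 M).
apply: (tor_zero_of_flat_cover (@free_flat R M) ex0).
have coverS := tensor_map_surj (f := (idfun : {linear I -> I}))
  (fun x => ex_intro _ x erefl) (@free_cover_surj R (syzygy1 M)).
have d0E u : tmapr I (syzygy1_incl M) (tmapr I (free_cover (syzygy1 M)) u)
    = tmapr I (syzygy_map M 0) u by exact: tensor_map_comp.
have d1E u : tmapr I (free_cover (syzygy1 M)) (tmapr I (syzygy_map M 1) u)
    = tmapr I (free_cover (syzygy1 M) \o syzygy_map M 1) u.
  exact: tensor_map_comp.
apply: injective0 => t; have [u <-] := coverS t => du.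
have /exI[w <-] := etrans (esym (d0E u)) du; apply: (etrans (d1E w)).
apply: tensor_map0; right => x /=; exact: exact_comp0 ex1.
Qed.

Lemma tor_zero_Tor1_eq0 I M : tor_zero I M -> Tor1_eq0 I M.
Proof.
move=> torM [P d e Pproj dd de eS] /=.
have [K [k [kI ke]]] := kernel_exists e.
have kI' := tor_zero_injective torM (And3 kI ke eS).
have [|c cE] := @factor_injective _ K _ _ k (d 0%N) kI.
  by move=> x; apply/ke; exact: exact_comp0 de.
have cS y : exists x, c x = y.
  have /de[x dx] : e (k y) = 0 by exact: exact_comp0 ke.
  by exists x; apply: kI; rewrite cE.
have dc : exact_at (d 1%N) c.
  move=> x; split=> [cx|[y <-]].
    by apply/dd; rewrite -cE cx linear0.
  by apply: kI; rewrite cE linear0; exact: exact_comp0 (dd 0%N).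
have ex := tensor_right_exactr (A := I) dc cS.
have dE t : tmapr I (d 0%N) t = tmapr I k (tmapr I c t).
  by symmetry; exact: tensor_map_comp.
move=> t; rewrite dE; split=> [/(injective_eq0 kI')/ex //|[s <-]].
by rewrite (exact_comp0 _ ex) raddf0.
Qed.

(** The iterated kernels in flat resolutions of injective right modules.  By
    dimension shifting on that side, Tor_1(N, M) = 0 for all such [N] amounts to
    Tor_i(I, M) = 0 for all i > 0 and all injective I. *)
Inductive injective_syzygy : rmodType R -> Prop :=
| InjSyzygy0 I : injective_module I -> injective_syzygy I
| InjSyzygyS N P I (i : {linear N -> P}) (p : {linear P -> I}) :
    short_exact i p -> right_flat P -> injective_syzygy I -> injective_syzygy N.

Definition all_tor_zero M := forall N, injective_syzygy N -> tor_zero N M.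

Lemma all_tor_zero_injective M I :
  all_tor_zero M -> injective_module I -> tor_zero I M.
Proof. by move=> torM /InjSyzygy0/torM. Qed.

(** Since F is flat, Tor_1(I, A) is Tor_2(I, M), that is Tor_1(N, M) for the
    first syzygy N of I.  Concretely, N (x) A -> N (x) F and N (x) F -> P (x) F
    are injective, for P the free cover of I, and their composite factors through
    N (x) A -> P (x) A. *)
Lemma all_tor_zero_flat_kernel A F M
    (f : {linear A -> F}) (g : {linear F -> M}) :
  flat F -> short_exact f g -> all_tor_zero M -> all_tor_zero A.
Proof.
move=> Ff fg torM I SI; have ip := syzygy1_exact I.
have SN := InjSyzygyS ip (@free_right_flat R I) SI.
have NfI := tor_zero_injective (torM _ SN) fg.
have [iI _ _] := ip; have iFI := flat_tensor_injective Ff iI.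
apply: (tor_zero_of_right_flat_cover ip (@free_right_flat R I)) => s t st.
apply/NfI/iFI; have sw := tensor_map_swap (syzygy1_incl I) f.
by apply: (etrans (esym (sw s))); rewrite st; exact: sw.
Qed.

End TorVanishing.

(** * Enough injective modules *)

Import Num.Theory.

Lemma int_subgroup_principal (J : int -> Prop) :
  J 0 -> (forall a b, J a -> J b -> J (a - b)) ->
  exists n : nat, forall k, J k <-> (n %| k)%Z.
Proof.
move=> J0 JB; have JN a : J a -> J (- a) by move=> /(JB _ _ J0); rewrite sub0r.
have JM a n : J a -> J (a *+ n).
  move=> Ja; elim: n => // n Jn; rewrite mulrSr -[a in _ + a]opprK.
  exact/JB/JN.
have JZ a b : J a -> J (b * a).
  move=> Ja; rewrite mulrC -mulrzz; case: b => n; first exact: JM.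
  by rewrite NegzE mulrNz; apply/JN/JM.
have [[n [n_gt0 Jn]]|noJ] := pselect (exists n : nat, (0 < n)%N /\ J n).
  pose P m := (0 < m)%N && `[< J m%:Z >].
  have exP : exists m, P m by exists n; rewrite /P n_gt0; apply/asboolP.
  case: (ex_minnP exP) => m /andP[m_gt0 /asboolP Jm] m_min.
  exists m => k; split=> [Jk|/dvdzP[q ->]]; last exact: JZ.
  have Jr : J (k %% m)%Z.
    by rewrite -[(k %% m)%Z]addr0 -(subrr ((k %/ m)%Z * m)) addrA
      [(k %% m)%Z + _]addrC -divz_eq; apply/JB/JZ.
  have m_neq0 : m%:Z != 0 by rewrite eqz_nat -lt0n.
  have [r rE] : exists r : nat, (k %% m)%Z = r.
    by exists `|(k %% m)%Z|%N; rewrite gez0_abs // modz_ge0.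
  apply/dvdz_mod0P; rewrite rE; case: r rE => // r rE.
  have /m_min : P r.+1 by apply/asboolP; rewrite -rE.
  by have := ltz_mod k m_neq0; rewrite rE /= ltz_nat ltnNge => /negbTE ->.
exists 0%N => k; split=> [Jk|]; last by rewrite dvd0z => /eqP ->.
rewrite dvd0z; apply: contra_notT noJ => k_neq0; exists `|k|%N.
rewrite absz_gt0 k_neq0; split=> //; rewrite abszE.
by case: (ger0P k) => _ //; exact: JN.
Qed.

(** The witness is Q/Z.  For n = 0 the second property only says that the group
    is not zero; it is used at elements of infinite order. *)
Lemma divisible_cogenerator_exists : exists D : zmodType,
  (forall (d : D) n, (0 < n)%N -> exists e, e *+ n = d) /\
  (forall n, n != 1%N -> exists d : D, d != 0 /\ d *+ n = 0).
Proof.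
pose Z : {pred rat} := fun q => q \is a Num.int.
have ZZ : zmod_closed Z by split; [exact: rpred0 | exact: rpredB].
pose D := quotg ZZ; pose pi : {additive rat -> D} := quotg_pi ZZ.
exists D; split=> [d n n_gt0|n n_neq1].
  have [q <-] := quotg_pi_surj d; exists (pi (q / n%:R)).
  have qn : q / n%:R *+ n = q by rewrite -mulr_natr divfK // pnatr_eq0 -lt0n.
  by rewrite -raddfMn qn.
pose m := if n == 0%N then 2%N else n.
have m_gt1 : (1 < m)%N by rewrite /m; case: (n) n_neq1 => [|[|]].
have mV : m%:R * m%:R^-1 = 1 :> rat.
  by rewrite mulfV // pnatr_eq0 -lt0n ltnW.
exists (pi m%:R^-1); split.
  apply/eqP => /(quotg_pi_eq0 ZZ)/intrP[z zE].
  move: mV; rewrite zE -[m%:R]/(m%:Z%:~R) -intrM.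
  move=> /(@intr_inj rat _ 1) /(congr1 absz)/eqP.
  rewrite abszM muln_eq1 /= => /andP[/eqP m1].
  by rewrite m1 in m_gt1.
have mpi : pi m%:R^-1 *+ m = 0.
  have -> : pi m%:R^-1 *+ m = pi (m%:R * m%:R^-1) by rewrite mulr_natl raddfMn.
  rewrite mV; apply/(quotg_pi_eq0 ZZ); exact: rpred1.
by move: mpi; rewrite {2}/m; case: (n == 0%N) / eqP => [->|].
Qed.

Lemma pair_mulrz (U V : zmodType) (u : U) (v : V) k :
  (u, v) *~ k = (u *~ k, v *~ k).
Proof.
by rewrite [LHS]surjective_pairing (raddfMz (@fst U V)) (raddfMz (@snd U V)).
Qed.

Section DivisibleGroup.
Variable D : zmodType.
Hypothesis D_divisible :
  forall (d : D) n, (0 < n)%N -> exists e, e *+ n = d.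

Section Extension.
Variable V : zmodType.

(** Homomorphisms from a subgroup of [V] to [D], as graphs. *)
Definition partial_hom (G : V * D -> Prop) :=
  [/\ G 0, forall x y, G x -> G y -> G (x - y) & forall d, G (0, d) -> d = 0].

Lemma partial_homZ G x k : partial_hom G -> G x -> G (x *~ k).
Proof.
move=> [G0 GB _] Gx; have GN y : G y -> G (- y) by rewrite -sub0r; exact: GB.
have Gn n : G (x *+ n).
  elim: n => // n Gn; rewrite mulrSr -[x in _ + x]opprK.
  exact/GB/GN.
by case: k => n; rewrite ?NegzE ?mulrNz; last apply: GN; exact: Gn.
Qed.

(** The multiples of [v] at which [G] is defined are those by n Z for some n;
    the value at n v determines the others, and [d] is an n-th part of it. *)
Lemma partial_hom_value G v :
  partial_hom G -> exists d, forall k y, G (v *~ k, y) -> y = d *~ k.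
Proof.
move=> homG; have [G0 GB Gfun] := homG.
have [||n Jn] := @int_subgroup_principal (fun k => exists y, G (v *~ k, y)).
- by exists 0; rewrite mulr0z.
- move=> a b [y Gy] [z Gz]; exists (y - z); rewrite mulrzBr.
  exact: GB Gy Gz.
have [y0 Gy0] : exists y, G (v *~ n, y) by apply/Jn; exact: dvdzz.
have [d dE] : exists d, d *+ n = y0.
  case: n {Jn} y0 Gy0 => [|n] y0 Gy0; last exact: D_divisible.
  by exists 0; rewrite mulr0n (Gfun y0).
exists d => k y Gy; have /dvdzP[q kE] : (n %| k)%Z by apply/Jn; exists y.
apply/eqP; rewrite -subr_eq0; apply/eqP/Gfun.
have -> : (0, y - d *~ k) = (v *~ k, y) - (v *~ n, y0) *~ q :> V * D.
  rewrite pair_mulrz kE mulrC 2!mulrzA -[in RHS]dE.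
  by congr (_, _); rewrite /= subrr.
exact: GB Gy (partial_homZ _ homG Gy0).
Qed.

(** A maximal extension, by Zorn, of a homomorphism defined on a subgroup is
    defined everywhere, since it extends to one more element. *)
Lemma partial_hom_extend G :
  partial_hom G ->
  exists f : {additive V -> D}, forall v d, G (v, d) -> f v = d.
Proof.
move=> homG; have [G0 GB Gfun] := homG.
(* The empty graph is good too, which provides a bound for the empty chain. *)
pose good (H : set (V * D)) := [/\ forall x y, H x -> H y -> H (x - y),
  forall d, H (0, d) -> d = 0 & (exists x, H x) -> forall x, G x -> H x].
have [F Fgood Fchain|H [[HB Hfun GH] Hmax]] := @Zorn_bigcup _ good.
  split=> [x y [X FX Xx] [Y FY Yy]|d [X FX Xd]|[x [X FX Xx]] y Gy].
  - have [XY|YX] := Fchain _ _ FX FY.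
      exists Y => //; have [YB _ _] := Fgood _ FY.
      by apply: YB => //; exact: XY.
    exists X => //; have [XB _ _] := Fgood _ FX.
    by apply: XB => //; exact: YX.
  - by have [_ Xfun _] := Fgood _ FX; exact: Xfun.
  - by exists X => //; have [_ _ GX] := Fgood _ FX; apply: GX => //; exists x.
have Hne : exists x, H x.
  apply: contrapT => Hempty; apply: (Hmax G); last by split.
  split=> [x Hx|GsubH]; first by case: Hempty; exists x.
  by case: Hempty; exists 0; exact: GsubH.
have {}GH := GH Hne; have homH : partial_hom H by split=> //; exact: GH.
have Htotal v : exists d, H (v, d).
  have [d dE] := partial_hom_value v homH; exists d.
  pose H' (x : V * D) := exists k : int, H (x - (v, d) *~ k).
  have HH' x : H x -> H' x.
    by move=> Hx; exists 0; rewrite mulr0z subr0.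
  have H'v : H' (v, d) by exists 1; rewrite mulr1z subrr; exact: GH.
  apply: contrapT => NHv; apply: (Hmax H').
    by split=> // H'H; apply/NHv/H'H.
  split=> [x y [k Hx] [l Hy]|e [k He]|_ x /GH/HH' //].
    exists (k - l); have := HB _ _ Hx Hy.
    by rewrite mulrzBr !opprD !opprK addrACA.
  have := dE (- k) (e - d *~ k); rewrite !mulrNz -[- (v *~ k)]sub0r.
  rewrite pair_mulrz in He => /(_ He)/eqP.
  by rewrite subr_eq addNr => /eqP.
have Hinj v d e : H (v, d) -> H (v, e) -> d = e.
  move=> Hd He; have := HB _ _ Hd He; rewrite -[_ - _]/(v - v, d - e) subrr.
  by move=> /Hfun/eqP; rewrite subr_eq0 => /eqP.
have [f fH] := choice Htotal.
have fB : zmod_morphism f.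
  by move=> x y; apply: Hinj (fH _) _; exact: HB (fH x) (fH y).
exists (additive_of fB) => v d /GH Hd; exact: Hinj (fH v) Hd.
Qed.

End Extension.

Lemma additive_extension (U V : zmodType) (i : {additive U -> V})
    (f : {additive U -> D}) :
  injective i -> exists h : {additive V -> D}, forall u, h (i u) = f u.
Proof.
move=> iI; pose G := fun x : V * D => exists u, i u = x.1 /\ f u = x.2.
have [|h hG] := @partial_hom_extend V G.
  split=> [|x y [u [iu fu]] [v [iv fv]]|d [u /= [iu <-]]].
  - by exists 0; rewrite !raddf0.
  - by exists (u - v); rewrite !raddfB /= iu iv fu fv.
  - by rewrite (injective_eq0 iI iu) raddf0.
by exists h => u; apply: hG; exists u.
Qed.

Hypothesis D_torsion : forall n, n != 1%N -> exists d : D, d != 0 /\ d *+ n = 0.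

(** Let n be the order of [v], or 0 if it is infinite.  A nonzero d with n d = 0
    defines a homomorphism on the cyclic group of [v], which extends to [V]. *)
Lemma additive_separation (V : zmodType) (v : V) :
  v != 0 -> exists f : {additive V -> D}, f v != 0.
Proof.
move=> v_neq0.
have [||n nE] := @int_subgroup_principal (fun k => v *~ k = 0).
- exact: mulr0z.
- by move=> a b va vb; rewrite mulrzBr va vb subrr.
have [d [d_neq0 dn]] : exists d : D, d != 0 /\ d *+ n = 0.
  apply: D_torsion; apply: contra_neq v_neq0 => n1.
  by rewrite -[v]mulr1z; apply/nE; rewrite n1.
pose G := fun x : V * D => exists k : int, x = (v *~ k, d *~ k).
have [|f fG] := @partial_hom_extend V G; last first.
  by exists f; rewrite (fG v d) //; exists 1; rewrite !mulr1z.
split=> [|_ _ [k ->] [l ->]|e [k [vk ->]]].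
- by exists 0; rewrite !mulr0z.
- by exists (k - l); rewrite !mulrzBr.
- have /dvdzP[q ->] : (n %| k)%Z by apply/nE.
  by rewrite mulrC mulrzA -pmulrn dn mul0rz.
Qed.

End DivisibleGroup.

(** The module of additive maps from [S] to the power [D^X], acted upon through
    the argument in [S]. *)
Section CoinducedModule.
Variables (S : pzRingType) (X : choiceType) (D : zmodType).

Definition coind_pred : {pred X -> S -> D} :=
  fun phi => `[< forall x, zmod_morphism (phi x) >].

Lemma coind_zmod_closed : zmod_closed coind_pred.
Proof.
split=> [|f g /asboolP fB /asboolP gB]; apply/asboolP => x r s.
  by rewrite subrr.
rewrite -![(f - g) x _]/(f x _ - g x _) fB gB.
by rewrite !opprD !opprK addrACA.
Qed.

HB.instance Definition _ :=
  GRing.isZmodClosed.Build (X -> S -> D) coind_pred coind_zmod_closed.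

Record coind :=
  Coind { coind_fun :> X -> S -> D; _ : coind_fun \in coind_pred }.

HB.instance Definition _ := [isSub for coind_fun].
HB.instance Definition _ := [Choice of coind by <:].
HB.instance Definition _ := [SubChoice_isSubZmodule of coind by <:].

Lemma coind_additive (f : coind) x : zmod_morphism (f x).
Proof. by case: f => f /= /asboolP. Qed.

Lemma coindP (f g : coind) : (forall x r, f x r = g x r) -> f = g.
Proof.
move=> fg; apply: val_inj; apply: functional_extensionality_dep => x.
by apply: functional_extensionality_dep => r; exact: fg.
Qed.

Lemma coind_scale_subproof (a : S) (f : coind) :
  (fun x r => f x (r * a)) \in coind_pred.
Proof. by apply/asboolP => x r s; rewrite mulrBl coind_additive. Qed.

Definition coind_scale a f : coind := Coind (coind_scale_subproof a f).

Lemma coind_scaleA a b f :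
  coind_scale a (coind_scale b f) = coind_scale (a * b) f.
Proof. by apply: coindP => x r /=; rewrite mulrA. Qed.
Lemma coind_scale1 : left_id 1 coind_scale.
Proof. by move=> f; apply: coindP => x r /=; rewrite mulr1. Qed.
Lemma coind_scaleDr : right_distributive coind_scale +%R.
Proof. by move=> a f g; apply: coindP. Qed.
Lemma coind_scaleDl f : {morph coind_scale^~ f : a b / a + b}.
Proof.
move=> a b; apply: coindP => x r.
by have := raddfD (additive_of (coind_additive f x)) (r * a) (r * b);
  rewrite -mulrDr.
Qed.
HB.instance Definition _ := GRing.Zmodule_isLmodule.Build S coind
  coind_scaleA coind_scale1 coind_scaleDr coind_scaleDl.

Lemma coind_of_additive (V : lmodType S) (g : X -> {additive V -> D}) :
  exists h : {linear V -> coind}, forall v x r, h v x r = g x (r *: v).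
Proof.
have hP v : (fun x r => g x (r *: v)) \in coind_pred.
  by apply/asboolP => x r s; rewrite scalerBl raddfB.
have [|h hE] := @linear_of S V coind (fun v => Coind (hP v)).
  move=> a u v; apply: coindP => x r /=.
  by rewrite scalerDr raddfD scalerA.
by exists h => v x r; rewrite hE.
Qed.

(** A linear map to the coinduced module is a family of additive maps to [D],
    namely its values at 1, so extending the former is extending the latter. *)
Lemma coind_injective :
  (forall (d : D) n, (0 < n)%N -> exists e, e *+ n = d) ->
  injective_module (coind : lmodType S).
Proof.
move=> Ddiv U V i f iI.
have fB x : zmod_morphism (fun u => f u x 1) by move=> u v; rewrite linearB.
have /choice[g gE] x : exists g : {additive V -> D},
    forall u, g (i u) = additive_of (fB x) u.
  exact: (@additive_extension _ Ddiv _ _ i (additive_of (fB x)) iI).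
have [h hE] := coind_of_additive g; exists h => u; apply: coindP => x r.
by rewrite /= hE -linearZ gE /= linearZ /= mul1r.
Qed.

End CoinducedModule.

Lemma enough_injectives (S : pzRingType) (M : lmodType S) :
  exists (I : lmodType S) (e : {linear M -> I}),
    injective_module I /\ injective e.
Proof.
have [D [Ddiv Dtor]] := divisible_cogenerator_exists.
have /choice[g gE] (x : M) : exists g : {additive M -> D}, x != 0 -> g x != 0.
  have [->|x_neq0] := eqVneq x 0; first by exists (GRing.null_fun _).
  by have [g gx] := additive_separation Ddiv Dtor x_neq0; exists g.
have [e eE] := coind_of_additive g.
exists (coind S M D), e; split; first exact: coind_injective.
apply: linear_injective0 => m em0; apply/eqP; apply: contraT => /gE.
by rewrite -[m in g m m]scale1r -eE em0 eqxx.
Qed.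

(** * Gorenstein flat modules through short exact sequences *)

Lemma eq_exact_at (U V W : zmodType) (f f' : U -> V) (g g' : V -> W) :
  f =1 f' -> g =1 g' -> exact_at f g -> exact_at f' g'.
Proof.
move=> ff' gg' fg v; rewrite -gg'; split=> [/fg[u <-]|[u <-]].
  by exists u; rewrite -ff'.
by apply/fg; exists u; rewrite ff'.
Qed.

Section GorensteinFlat.
Variables (R : pzRingType).
Implicit Types (A B C D E F G H K M X : lmodType R) (I : rmodType R).

Lemma tensor_splice I A B C D K (p : {linear K -> A}) (i : {linear A -> B})
    (q : {linear B -> C}) (j : {linear C -> D}) :
  (forall a, exists z, p z = a) -> short_exact i q -> injective (tmapr I j) ->
  exact_at (tmapr I (i \o p : {linear K -> B}))
           (tmapr I (j \o q : {linear B -> D})).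
Proof.
move=> pS [_ iq qS] jI.
have pS' := tensor_map_surj (f := (idfun : {linear I -> I}))
  (fun x => ex_intro _ x erefl) pS.
apply: eq_exact_at (exact_splice pS' (tensor_right_exactr (A := I) iq qS) jI).
  by move=> t; exact: tensor_map_comp.
by move=> t; exact: tensor_map_comp.
Qed.

Definition scons X (Y : nat -> lmodType R) n : lmodType R :=
  if n is n'.+1 then Y n' else X.

(** The same complex with F^0 (here), respectively F_0 (below), counted in the
    other half. *)
Definition shift_up (F : biseq R) : biseq R :=
  @Biseq R (scons (upper F 0) (lower F)) (fun n => upper F n.+1)
    (fun n => if n is n'.+1 return
        {linear lower F n -> scons (upper F 0) (lower F) n}
      then lower_map F n' else middle F)
    (upper_map F 0) (fun n => upper_map F n.+1).

Definition shift_down (F : biseq R) : biseq R :=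
  @Biseq R (fun n => lower F n.+1) (scons (lower F 0) (upper F))
    (fun n => lower_map F n.+1) (lower_map F 0)
    (fun n => if n is n'.+1 return
        {linear scons (lower F 0) (upper F) n -> upper F n}
      then upper_map F n' else middle F).

Lemma Gorenstein_flat_cosyzygy M : Gorenstein_flat M ->
  exists F M' (i : {linear M -> F}) (p : {linear F -> M'}),
    [/\ flat F, short_exact i p & Gorenstein_flat M'].
Proof.
case=> F [[lF uF] [ex1 ex2 ex3 ex4] tF [i [iI iE]]].
have [M' [p [ip pS]]] := cokernel_exists i.
exists (upper F 0), M', i, p; split=> //.
have iu y : (exists x, i x = y) <-> upper_map F 0 y = 0.
  by rewrite iE; split=> /ex3.
have [|j jE] := @factor_surjective _ _ _ _ p (upper_map F 0) pS.
  by move=> y /ip/iu.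
exists (shift_up F); split.
- by split=> [[|n]|n]; [exact: uF | exact: lF | exact: uF].
- split=> [[|n]|||n]; [exact: ex2 | exact: ex1 | exact: ex3 | | exact: ex4].
  exact: (ex4 0%N).
- move=> I /tF[t1 t2 t3 t4].
  split=> [[|n]|||n]; [exact: t2 | exact: t1 | exact: t3 | | exact: t4].
  exact: (t4 0%N).
- exists j; split.
    apply: linear_injective0 => m; have [y <-] := pS m.
    by rewrite jE => /iu/ip.
  move=> y; split=> [[m <-]|[x <-]]; last by exists (p x).
  by have [x <-] := pS m; exists x; rewrite jE.
Qed.

(** The kernel of F_0 -> M is the image of F_1, so that the exactness of
    I (x) F_2 -> I (x) F_1 -> I (x) F_0 says that it stays a subgroup of
    I (x) F_0 after tensoring. *)
Lemma Gorenstein_flat_syzygy M : Gorenstein_flat M ->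
  exists M' F (i : {linear M' -> F}) (p : {linear F -> M}),
    [/\ flat F, short_exact i p, Gorenstein_flat M' &
        forall I, injective_module I -> injective (tmapr I i)].
Proof.
case=> F [[lF uF] [ex1 ex2 ex3 ex4] tF [i [iI iE]]].
have [|p pE] := @factor_injective _ _ _ _ i (middle F) iI.
  by move=> x; apply/iE; exists x.
have pS m : exists x, p x = m.
  have /iE[x xm] : exists n, i n = i m by exists m.
  by exists x; apply: iI; rewrite pE.
have [M' [k [kI kp]]] := kernel_exists p.
have p0 x : p x = 0 <-> middle F x = 0.
  rewrite -pE; split=> [->|/(linear_injective_eq0 iI) //]; exact: linear0.
have kE y : (exists x, k x = y) <-> exists x, lower_map F 0 x = y.
  by split=> [/kp/p0/ex2|/ex2/p0/kp].
exists M', (lower F 0), k, p; split=> //.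
  exists (shift_down F); split.
  - by split=> [n|[|n]]; [exact: lF | exact: lF | exact: uF].
  - split=> [n|||[|n]]; [exact: ex1 | | exact: ex2 | exact: ex3 | exact: ex4].
    exact: (ex1 0%N).
  - move=> I /tF[t1 t2 t3 t4].
    split=> [n|||[|n]]; [exact: t1 | | exact: t2 | exact: t3 | exact: t4].
    exact: (t1 0%N).
  - by exists k; split.
move=> I /tF[t1 _ _ _].
have [|c cE] := @factor_injective _ _ _ _ k (lower_map F 0) kI.
  by move=> x; apply/kE; exists x.
have cS y : exists x, c x = y.
  have /kE[x xy] : exists z, k z = k y by exists y.
  by exists x; apply: kI; rewrite cE.
have cS' := tensor_map_surj (f := (idfun : {linear I -> I}))
  (fun x => ex_intro _ x erefl) cS.
have kcE u : tmapr I k (tmapr I c u) = tmapr I (lower_map F 0) u.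
  exact: tensor_map_comp.
have cdE u : tmapr I c (tmapr I (lower_map F 1) u)
    = tmapr I (c \o lower_map F 1 : {linear _ -> _}) u.
  exact: tensor_map_comp.
apply: injective0 => t; have [u <-] := cS' t => ku.
have /t1[w <-] := etrans (esym (kcE u)) ku; apply: (etrans (cdE w)).
apply: tensor_map0; right => x /=; apply: (linear_injective_eq0 kI).
by rewrite cE; exact: exact_comp0 (ex1 0%N).
Qed.

(** Dimension shifting on both sides at once: for a kernel N of P -> I, the
    syzygy M' of M reduces Tor_1(N, M) to Tor_1(I, M'). *)
Lemma Gorenstein_flat_all_tor_zero M : Gorenstein_flat M -> all_tor_zero M.
Proof.
move=> GM N SN; elim: SN M GM => {N} [I Iinj|N P I i p ip Pf _ IH] M GM.
  have [M' [F [k [q [Ff kq _ kI]]]]] := Gorenstein_flat_syzygy GM.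
  exact: tor_zero_of_flat_cover Ff kq (kI _ Iinj).
have [M' [F [k [q [Ff kq GM' _]]]]] := Gorenstein_flat_syzygy GM.
apply: (tor_zero_of_flat_cover Ff kq) => s t st.
have [kI _ _] := kq; apply/(IH _ GM' _ _ _ _ ip)/(Pf _ _ _ kI).
have sw := tensor_map_swap i k.
by rewrite [LHS]sw st; exact: esym (sw t).
Qed.

Record coresolution_step X := CoresolutionStep {
  step_flat : lmodType R;
  step_next : lmodType R;
  step_incl : {linear X -> step_flat};
  step_proj : {linear step_flat -> step_next};
  step_flatP : flat step_flat;
  step_exact : short_exact step_incl step_proj
}.

(** Iterating the embeddings gives the right half of the sequence and a free
    resolution gives the left half.  Each of its spots is a splice of two short
    exact sequences, and the vanishing of Tor for the modules at which the
    sequences are spliced keeps it exact under I (x) -. *)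
Lemma Gorenstein_flat_coind (Q : lmodType R -> Prop) :
  (forall X, Q X -> all_tor_zero X /\
     exists F X' (i : {linear X -> F}) (p : {linear F -> X'}),
       [/\ flat F, short_exact i p & Q X']) ->
  forall M, Q M -> Gorenstein_flat M.
Proof.
move=> Qstep M QM.
have next (X : {X | Q X}) :
    {s : coresolution_step (sval X) | Q (step_next s)}.
  apply: cid; have [_ [F [X' [i [p [Ff ip QX']]]]]] := Qstep _ (svalP X).
  by exists (CoresolutionStep Ff ip).
pose nextX (X : {X | Q X}) : {X | Q X} :=
  exist Q (step_next (sval (next X))) (svalP (next X)).
pose X n := iter n nextX (exist Q M QM).
pose s n := sval (next (X n)).
have torX n : all_tor_zero (sval (X n)) by have [] := Qstep _ (svalP (X n)).
have torS n : all_tor_zero (syzygy M n).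
  elim: n => [|n IH]; first exact: (torX 0%N).
  exact: all_tor_zero_flat_kernel (@free_flat R _) (syzygy1_exact _) IH.
have sI n : injective (step_incl (s n)) by have [] := step_exact (s n).
have sE n : exact_at (step_incl (s n)) (step_proj (s n)).
  by have [] := step_exact (s n).
have sS n y : exists x, step_proj (s n) x = y.
  by have [_ _] := step_exact (s n).
have sT I n : injective_module I -> injective (tmapr I (step_incl (s n))).
  move=> Iinj; apply: tor_zero_injective (step_exact (s n)).
  exact: all_tor_zero_injective (torX n.+1) Iinj.
have cS := @free_cover_surj R.
have cE n : short_exact (syzygy1_incl (syzygy M n)) (free_cover (syzygy M n)).
  exact: syzygy1_exact.
have cI n : injective (syzygy1_incl (syzygy M n)) by have [] := cE n.
have cT I n : injective_module I ->
    injective (tmapr I (syzygy1_incl (syzygy M n))).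
  move=> Iinj; apply: tor_zero_injective (cE n).
  exact: all_tor_zero_injective (torS n) Iinj.
pose F := @Biseq R (fun n => free_mod R (syzygy M n)) (fun n => step_flat (s n))
  (syzygy_map M) (step_incl (s 0%N) \o free_cover M)
  (fun n => step_incl (s n.+1) \o step_proj (s n)).
exists F; split.
- by split=> n; [exact: free_flat | exact: step_flatP].
- split=> [n|||n].
  + exact: syzygy_map_exact.
  + have [_ ex _] := cE 0%N; exact: exact_splice (cS _) ex (sI 0%N).
  + exact: exact_splice (cS _) (sE 0%N) (sI 1%N).
  + exact: exact_splice (sS n) (sE n.+1) (sI n.+2).
- move=> I Iinj; split=> [n|||n].
  + exact: tensor_splice (cS _) (cE n.+1) (cT _ n Iinj).
  + exact: tensor_splice (cS _) (cE 0%N) (sT _ 0%N Iinj).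
  + exact: tensor_splice (cS _) (step_exact (s 0%N)) (sT _ 1%N Iinj).
  + exact: tensor_splice (sS n) (step_exact (s n.+1)) (sT _ n.+2 Iinj).
- exists (step_incl (s 0%N)); split; first exact: sI.
  move=> y; split=> [[m <-]|[x <-]]; last by exists (free_cover M x).
  by have [x <-] := cS _ m; exists x.
Qed.

End GorensteinFlat.

(** * Closure properties *)

Section ClosureProperties.
Variables (R : pzRingType).
Implicit Types (A B C D E F G H M X : lmodType R) (I : rmodType R).

(** The flat coresolution of E, preceded by F, is one of A, and Tor vanishes for
    A by dimension shifting. *)
Lemma Gorenstein_flat_kernel A F E (f : {linear A -> F}) (g : {linear F -> E}) :
  flat F -> short_exact f g -> Gorenstein_flat E -> Gorenstein_flat A.
Proof.
move=> Ff fg GE.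
pose Q X := exists F E (i : {linear X -> F}) (p : {linear F -> E}),
  [/\ flat F, short_exact i p & Gorenstein_flat E].
apply: (@Gorenstein_flat_coind R Q); last by exists F, E, f, g.
move=> X [F' [E' [i [p [F'f ip GE']]]]]; split.
  exact: all_tor_zero_flat_kernel F'f ip (Gorenstein_flat_all_tor_zero GE').
by exists F', E', i, p; split=> //; exact: Gorenstein_flat_cosyzygy.
Qed.

Lemma flat_Gorenstein_flat F : flat F -> Gorenstein_flat F.
Proof.
apply: (@Gorenstein_flat_coind R (@flat R)) => {}F Ff; split.
  by move=> I _; exact: flat_tor_zero.
have [Z Z0] := zero_module_exists R.
exists F, Z, idfun, (GRing.null_fun _); split=> //.
  split=> // [y|z]; last by exists 0; rewrite (Z0 z) linear0.
  by split=> // _; exists y.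
apply: flat_of_injective => A B f fI; apply: injective0 => t _.
rewrite -[t](tensor_map_id (f := idfun) (g := idfun)) // tensor_map0 //.
by right=> z; exact: Z0.
Qed.

Lemma flat_extension A B C : ses A B C -> flat A -> flat C -> flat B.
Proof.
move=> [f [g fg]] Af Cf; apply: flat_of_tor_zero => I.
exact: tor_zero_extension fg (flat_tor_zero Af) (flat_tor_zero Cf).
Qed.

(** Embed A in a flat F0 with Gorenstein flat cokernel A'.  The pushout D' of D
    and F0 under A is an extension of the flat F by F0, hence flat, and the
    cokernel of D -> D' is A'. *)
Lemma Gorenstein_flat_extension_by_flat A D F :
  ses A D F -> Gorenstein_flat A -> flat F -> Gorenstein_flat D.
Proof.
move=> [f [g fg]] /Gorenstein_flat_cosyzygy[F0 [A' [i [p [F0f ip GA']]]]] Ff.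
have [D' [[u [v uv]] F0D'F]] := pushout_ses fg ip.
exact: Gorenstein_flat_kernel (flat_extension F0D'F F0f Ff) uv GA'.
Qed.

(** For A inside an injective I, the composite of A (x) F1 -> I (x) F1 and
    I (x) F1 -> I (x) F is injective and factors through A (x) F1 -> A (x) F. *)
Lemma flat_of_tor_zero_injective E F1 F (f : {linear F1 -> F})
    (g : {linear F -> E}) :
  flat F1 -> flat F -> short_exact f g ->
  (forall I, injective_module I -> tor_zero I E) -> flat E.
Proof.
move=> F1f Ff fg torE; apply: flat_of_tor_zero => A.
have [I [e [Iinj eI]]] := enough_injectives A.
apply: (tor_zero_of_flat_cover Ff fg) => s t st.
apply/(flat_tensor_injective F1f eI)/(tor_zero_injective (torE _ Iinj) fg).
have sw := tensor_map_swap e f.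
by rewrite [LHS]sw st; exact: esym (sw t).
Qed.

Definition cokernel_condition :=
  forall (G1 G0 M : lmodType R) (f : {linear G1 -> G0}) (g : {linear G0 -> M}),
    short_exact f g -> Gorenstein_flat G0 -> Gorenstein_flat G1 ->
    (forall I : rmodType R, injective_module I -> Tor1_eq0 I M) ->
    Gorenstein_flat M.

(** Closure under kernels.  Present C as F / C' with F flat and C' Gorenstein
    flat.  The pullback D of B and F over C is an extension of B by C', and has
    A as a submodule with D / A = F.  Embed D in a flat F0 with Gorenstein flat
    cokernel D'.  Then E = F0 / A is an extension of D' by F, and A is the kernel
    of F0 -> E. *)
Lemma GF_closed_projectively_resolving :
  left_GF_closed R -> projectively_resolving (@Gorenstein_flat R).
Proof.
move=> GFext; split=> [P /projective_flat|//|A B C f g fg GB GC].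
  exact: flat_Gorenstein_flat.
have [C' [F [k [q [Ff kq GC' _]]]]] := Gorenstein_flat_syzygy GC.
have [D [[u [v uv]] [w [z wz]]]] := pullback_ses fg kq.
have GD : Gorenstein_flat D := GFext _ _ _ _ _ wz GC' GB.
have [F0 [D' [i [p [F0f ip GD']]]]] := Gorenstein_flat_cosyzygy GD.
have [E [[a [b ab]] [c [d cd]]]] := quotient_ses uv ip.
apply: Gorenstein_flat_kernel F0f ab _.
exact: GFext _ _ _ _ _ cd (flat_Gorenstein_flat Ff) GD'.
Qed.

(** Embed G1 in a flat F1 with Gorenstein flat cokernel H.  The pushout D of G0
    and F1 under G1 is an extension of H by G0 that contains F1 with D / F1 = M.
    Embed D in a flat F with Gorenstein flat cokernel G.  Then E = F / F1 is an
    extension of G by M, so Tor_1(I, E) = 0 for all injective I and E is flat;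
    and M is the kernel of E -> G. *)
Lemma GF_closed_cokernel_condition : left_GF_closed R -> cokernel_condition.
Proof.
move=> GFext G1 G0 M f g fg GG0 GG1 torM.
have [F1 [H [i [p [F1f ip GH]]]]] := Gorenstein_flat_cosyzygy GG1.
have [D [[u [v uv]] [w [z wz]]]] := pushout_ses fg ip.
have GD : Gorenstein_flat D := GFext _ _ _ _ _ uv GG0 GH.
have [F [G [j [q [Ff jq GG]]]]] := Gorenstein_flat_cosyzygy GD.
have [E [[a [b ab]] [c [d cd]]]] := quotient_ses wz jq.
apply: (Gorenstein_flat_kernel _ cd GG).
apply: flat_of_tor_zero_injective F1f Ff ab _ => I Iinj.
apply: tor_zero_extension cd (Tor1_eq0_tor_zero (torM _ Iinj)) _.
exact: all_tor_zero_injective (Gorenstein_flat_all_tor_zero GG) Iinj.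
Qed.

(** With C = F / C' as for the closure under kernels, D is now an extension of F
    by A and is Gorenstein flat in any case; B is the cokernel of C' -> D. *)
Lemma cokernel_condition_GF_closed : cokernel_condition -> left_GF_closed R.
Proof.
move=> cokerGF A B C f g fg GA GC.
have [C' [F [k [q [Ff kq GC' _]]]]] := Gorenstein_flat_syzygy GC.
have [D [ADF [w [z wz]]]] := pullback_ses fg kq.
have GD := Gorenstein_flat_extension_by_flat ADF GA Ff.
apply: cokerGF wz GD GC' _ => I Iinj; apply: tor_zero_Tor1_eq0.
by apply: tor_zero_extension fg _ _;
  apply: all_tor_zero_injective Iinj; exact: Gorenstein_flat_all_tor_zero.
Qed.

End ClosureProperties.

Theorem theorem2p3 (R : pzRingType) :
  (left_GF_closed R <-> projectively_resolving (@Gorenstein_flat R)) /\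
  (projectively_resolving (@Gorenstein_flat R) <->
   (forall (G1 G0 M : lmodType R)
      (f : {linear G1 -> G0}) (g : {linear G0 -> M}),
      short_exact f g ->
      Gorenstein_flat G0 -> Gorenstein_flat G1 ->
      (forall I : rmodType R, injective_module I -> Tor1_eq0 I M) ->
      Gorenstein_flat M)).
Proof.
have resolving_closed : projectively_resolving (@Gorenstein_flat R) ->
    left_GF_closed R by case.
have closed_resolving := @GF_closed_projectively_resolving R.
split; split=> //.
- by move=> /resolving_closed; exact: GF_closed_cokernel_condition.
- by move=> /cokernel_condition_GF_closed; exact: closed_resolving.
Qed.
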